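(* Let $m,n\ge 1$, let $f,g:\mathbb{R}^n\times\mathbb{R}^m\to\mathbb{R}$ with $f$ of class $C^2$ and $g$ of class $C^3$. Write $g_x:=g(x,\cdot)$. Assume that there is $L_g>0$ such that for all $x\in\mathbb{R}^n$, $g_x$ is coercive and has an $L_g$-Lipschitz continuous gradient, and let $\alpha_g$ satisfy $0<\alpha_gL_g<1$. Let $(x^\star,z^\star)\in\mathbb{R}^n\times\mathbb{R}^m$ be a strong local minimizer of the bilevel problem $\min_{x,y} f(x,y)$ s.t. $y\in\operatorname{argmin} g(x,\cdot)$ (in the sense defined in the context). Then there exist $\delta>0$, $\gamma>0$, $C>0$ and $0<\rho<1$ such that for all $0<\alpha_f\le\gamma$ and all $k\in\mathbb{N}$, Algorithm DPBG with parameters $\alpha_f,\alpha_g,k$, initialized at any $(x,z)\in\mathbb{R}^n\times\mathbb{R}^m$ with $\|x-x^\star\|+\|z-z^\star\|<\delta$, satisfies $\|x_\ell-x^\star\|+\|z_\ell-z^\star\|\le\delta$ for all $\ell\in\mathbb{N}$ such that $$\ell\le\frac{\delta-\|x-x^\star\|-\|z-z^\star\|}{\alpha_fC\rho^k}.$$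
   Context: For a $C^2$ function $h$, a point $u^\star$ is a strong local minimizer of $h$ if $\nabla h(u^\star)=0$ and $\nabla^2h(u^\star)\succ0$. Strong local minimizer of the bilevel problem: a pair $(x^\star,z^\star)$ such that $z^\star$ is a strong local minimizer of $g_{x^\star}$ and, denoting by $y(\cdot)$ the $C^2$ map defined near $x^\star$ by the implicit function theorem with $\nabla_yg(x,y(x))=0$ and $y(x^\star)=z^\star$, the point $x^\star$ is a strong local minimizer of $\varphi:x\mapsto f(x,y(x))$. Lower-level gradient descent: $\mathcal{A}(x,z):=z-\alpha_g\nabla_yg(x,z)$, and $\mathcal{A}^k(x,z)$ is the result of $k$ iterations $y_j=\mathcal{A}(x,y_{j-1})$ started at $y_0=z$. Set $\varphi^k(x,z):=f(x,\mathcal{A}^k(x,z))$. Algorithm DPBG (differentiable programming bilevel gradient), with parameters $\alpha_f,\alpha_g,k$ and initialization $(x_0,z_0)$, is gradient descent on $\varphi^k$: for $\ell=1,2,\dots$, $$z_\ell=z_{\ell-1}-\alpha_f\nabla_z\varphi^k(x_{\ell-1},z_{\ell-1}),\qquad x_\ell=x_{\ell-1}-\alpha_f\nabla_x\varphi^k(x_{\ell-1},z_{\ell-1}).$$ *)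

(* Defs.v *)
From HB Require Import structures.
From mathcomp Require Export all_boot all_order all_algebra.
From mathcomp Require Export boolp classical_sets reals topology normedtype derive.

Set Implicit Arguments.
Unset Strict Implicit.
Unset Printing Implicit Defensive.

Export Order.TTheory GRing.Theory Num.Theory.
Export numFieldNormedType.Exports.

Local Open Scope classical_set_scope.
Local Open Scope ring_scope.

(* The library norm on 'rV[R]_d is the sup norm; the Lipschitz constants and
   the distances of the statement are Euclidean. *)
Definition enorm (R : realType) (d : nat) (u : 'rV[R]_d) : R :=
  Num.sqrt (\sum_(i < d) u ord0 i ^+ 2).

(* Class C^k on an open set U of a finite-dimensional space V. For k + 1: h is
   Frechet differentiable on U and x |-> 'd h x is of class C^k there. As V is
   finite-dimensional, the latter is equivalent to x |-> 'd h x v being of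
   class C^k for every direction v. *)
Fixpoint Ck_on (R : realType) (V W : normedModType R) (k : nat) (U : set V)
    (h : V -> W) : Prop :=
  match k with
  | 0 => forall x, U x -> {for x, continuous h}
  | k'.+1 => (forall x, U x -> differentiable h x) /\
             (forall v : V, Ck_on k' U (fun x => 'd h x v))
  end.

Definition grad (R : realType) (d : nat) (h : 'rV[R]_d -> R) (u : 'rV[R]_d) :
    'rV[R]_d :=
  \row_(i < d) 'D_(delta_mx ord0 i) h u.

Definition hess (R : realType) (d : nat) (h : 'rV[R]_d -> R) (u : 'rV[R]_d) :
    'M[R]_d :=
  \matrix_(i < d, j < d)
    'D_(delta_mx ord0 i) (fun w => 'D_(delta_mx ord0 j) h w) u.

(* Symmetry is not required: it is automatic for the Hessian of a C^2
   function. *)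
Definition posdefmx (R : realType) (d : nat) (H : 'M[R]_d) : Prop :=
  forall v : 'rV[R]_d, v != 0 -> 0 < (v *m H *m v^T) ord0 ord0.

Definition strong_local_minimizer (R : realType) (d : nat)
    (h : 'rV[R]_d -> R) (u : 'rV[R]_d) : Prop :=
  grad h u = 0 /\ posdefmx (hess h u).

Definition coercive (R : realType) (d : nat) (h : 'rV[R]_d -> R) : Prop :=
  forall A : R, exists r : R, forall u : 'rV[R]_d, r < enorm u -> A < h u.

Definition lipschitz_grad (R : realType) (d : nat) (L : R)
    (h : 'rV[R]_d -> R) : Prop :=
  forall u v : 'rV[R]_d, enorm (grad h u - grad h v) <= L * enorm (u - v).

Definition grad_y (R : realType) (n m : nat) (g : 'rV[R]_n * 'rV[R]_m -> R)
    (x : 'rV[R]_n) (y : 'rV[R]_m) : 'rV[R]_m :=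
  grad (fun w => g (x, w)) y.

(* y is, on the open neighborhood U of xs, the map of the implicit function
   theorem. It is represented by a total function; only its restriction to U
   is constrained. *)
Definition implicit_map (R : realType) (n m : nat)
    (g : 'rV[R]_n * 'rV[R]_m -> R) (xs : 'rV[R]_n) (zs : 'rV[R]_m)
    (U : set 'rV[R]_n) (y : 'rV[R]_n -> 'rV[R]_m) : Prop :=
  [/\ open U, U xs, Ck_on 2 U y, y xs = zs &
      forall x, U x -> grad_y g x (y x) = 0].

(* Since hess g(xs, .) is invertible at zs, the implicit function theorem
   provides such a y and makes its germ at xs unique, so quantifying it
   existentially or universally is the same. *)
Definition bilevel_strong_local_minimizer (R : realType) (n m : nat)
    (f g : 'rV[R]_n * 'rV[R]_m -> R) (xs : 'rV[R]_n) (zs : 'rV[R]_m) : Prop :=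
  strong_local_minimizer (fun y => g (xs, y)) zs /\
  exists (U : set 'rV[R]_n) (y : 'rV[R]_n -> 'rV[R]_m),
    implicit_map g xs zs U y /\
    strong_local_minimizer (fun x => f (x, y x)) xs.

Definition lower_gd (R : realType) (n m : nat)
    (g : 'rV[R]_n * 'rV[R]_m -> R) (alphag : R) (x : 'rV[R]_n)
    (z : 'rV[R]_m) : 'rV[R]_m :=
  z - alphag *: grad_y g x z.

Definition phik (R : realType) (n m : nat)
    (f g : 'rV[R]_n * 'rV[R]_m -> R) (alphag : R) (k : nat)
    (x : 'rV[R]_n) (z : 'rV[R]_m) : R :=
  f (x, iter k (lower_gd g alphag x) z).

Definition dpbg_step (R : realType) (n m : nat)
    (f g : 'rV[R]_n * 'rV[R]_m -> R) (alphaf alphag : R) (k : nat)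
    (p : 'rV[R]_n * 'rV[R]_m) : 'rV[R]_n * 'rV[R]_m :=
  (p.1 - alphaf *: grad (fun x => phik f g alphag k x p.2) p.1,
   p.2 - alphaf *: grad (fun z => phik f g alphag k p.1 z) p.2).

Definition dpbg (R : realType) (n m : nat)
    (f g : 'rV[R]_n * 'rV[R]_m -> R) (alphaf alphag : R) (k : nat)
    (p0 : 'rV[R]_n * 'rV[R]_m) (l : nat) : 'rV[R]_n * 'rV[R]_m :=
  iter l (dpbg_step f g alphaf alphag k) p0.

(* Main.v *)
(* Write A^k(x, z) for k lower-level steps from z. Near the minimizer A(x, .)
   contracts by a factor rho < 1 towards its fixed point y(x), so the error
   A^k(x, z) - y(x) and the derivative of A^k in z decay like rho^k. The
   derivative of A^k in x follows the recursion obtained by differentiating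
   A^(k+1)(x, z) = A(x, A^k(x, z)), whose coefficients are rho^k-close to those of
   the fixed point equation for y'(x): it tends to y'(x) at any rate rho' > rho.
   By the chain rule the gradient of phi^k is C rho'^k-close to
   (grad phi(x), 0). A small gradient step on phi does not increase the distance
   to xs, hence each step of DPBG increases the total distance by at most
   2 alphaf C rho'^k. *)
From HB Require Import structures.
Require Import Defs.
From mathcomp Require Import prodnormedzmodule functions landau ring lra.

Set Implicit Arguments.
Unset Strict Implicit.
Unset Printing Implicit Defensive.

Local Open Scope classical_set_scope.
Local Open Scope ring_scope.

(** * Euclidean norm and quadratic forms *)

(** The factor [rho] comes from the lower-level Hessian [H] at the minimizer: from
    [mu I <= H <= Lg I] and [alphag Lg < 1] follows [|(I - alphag H) w|^2 <= (1 - alphag mu) |w|^2].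
    This is a Euclidean fact, and in the sup norm, to which balls and differentials refer, the same
    map need not contract. Contractions are therefore carried in [enorm] and radii in the library
    norm; the dimension factors paid in between enter the constants and never [rho]. A second
    obstacle is that [Ck_on] speaks of one direction at a time, whereas the recursions need
    Lipschitz bounds uniform in the direction; these are recovered from a basis. Class C^3 of [g]
    makes the second derivatives locally Lipschitz, so that an orbit error of order [rho^k] perturbs
    the tangent recursion by the same order. A recursion of factor [rho] driven by such a term may
    grow like [k rho^k], which is why the rate is relaxed to a larger one. *)

Lemma psd_CauchySchwarz (R : realType) (V : lmodType R) (B : V -> V -> R)
    (Blin : forall a u v w, B (a *: u + v) w = a * B u w + B v w)
    (Bsym : forall u v, B u v = B v u) (Bpsd : forall u, 0 <= B u u) (u v : V) :
  B u v ^+ 2 <= B u u * B v v.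
Proof.
(* A nonnegative polynomial of degree at most 2 in [t]. If [B v v = 0] it is affine, and a nonzero
   slope would make it negative somewhere; otherwise its value at the minimizer [- B u v / B v v]
   gives the inequality. *)
have q t : 0 <= B u u + t * B u v *+ 2 + t ^+ 2 * B v v.
  have := Bpsd (t *: v + u).
  rewrite Blin [B v _]Bsym Blin [B u (_ + _)]Bsym Blin (Bsym v u); nra.
have [Bv0|Bv0] := eqVneq (B v v) 0.
  rewrite Bv0 mulr0; have [->|Buv0] := eqVneq (B u v) 0; first by rewrite expr0n.
  by have := q (- (B u u + 1) / B u v); have := Bpsd u; rewrite Bv0 mulr0 addr0 mulfVK//; lra.
have Bv : 0 < B v v by rewrite lt_def Bv0 Bpsd.
have := q (- B u v / B v v).
rewrite -subr_ge0 => h; rewrite -subr_ge0.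
suff -> : B u u * B v v - B u v ^+ 2 = (B u u + (- B u v / B v v) * B u v *+ 2 +
    (- B u v / B v v) ^+ 2 * B v v - 0) * B v v by rewrite mulr_ge0.
by field.
Qed.

Definition dot (R : realType) (d : nat) (u v : 'rV[R]_d) : R :=
  \sum_(i < d) u ord0 i * v ord0 i.

Section Euclid.
Context {R : realType} {d : nat}.
Implicit Types (u v w : 'rV[R]_d) (a : R).

Lemma dotC u v : dot u v = dot v u.
Proof. by apply: eq_bigr => i _; rewrite mulrC. Qed.

Lemma dotPl a u v w : dot (a *: u + v) w = a * dot u w + dot v w.
Proof.
by rewrite /dot mulr_sumr -big_split; apply: eq_bigr => i _; rewrite !mxE /=; ring.
Qed.

Lemma dotDl u v w : dot (u + v) w = dot u w + dot v w.
Proof. by have := dotPl 1 u v w; rewrite scale1r mul1r. Qed.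

Lemma dotZl a u v : dot (a *: u) v = a * dot u v.
Proof. by rewrite /dot mulr_sumr; apply: eq_bigr => i _; rewrite mxE mulrA. Qed.

Lemma dotDr u v w : dot u (v + w) = dot u v + dot u w.
Proof. by rewrite !(dotC u) dotDl. Qed.

Lemma dotZr a u v : dot u (a *: v) = a * dot u v.
Proof. by rewrite !(dotC u) dotZl. Qed.

Lemma dotBr u v w : dot u (v - w) = dot u v - dot u w.
Proof. by rewrite -[- w]scaleN1r dotDr dotZr mulN1r. Qed.

Lemma dot_gd_step u v a :
  dot (u - a *: v) (u - a *: v) = dot u u - a * (2 * dot u v - a * dot v v).
Proof. by rewrite -scaleNr dotDl !dotDr !dotZr !dotZl (dotC v u); ring. Qed.

Lemma dot_ge0 u : 0 <= dot u u.
Proof. by apply: sumr_ge0 => i _; rewrite -expr2 sqr_ge0. Qed.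

Lemma enorm_ge0 u : 0 <= enorm u.
Proof. exact: sqrtr_ge0. Qed.

Lemma enorm_sqr u : enorm u ^+ 2 = dot u u.
Proof.
rewrite sqr_sqrtr; last by apply: sumr_ge0 => i _; rewrite sqr_ge0.
by apply: eq_bigr => i _; rewrite expr2.
Qed.

Lemma enorm_le u a : 0 <= a -> dot u u <= a ^+ 2 -> enorm u <= a.
Proof. by move=> a0; rewrite -enorm_sqr ler_sqr ?nnegrE ?enorm_ge0. Qed.

Lemma dot0l u : dot 0 u = 0.
Proof. by rewrite -(scale0r u) dotZl mul0r. Qed.

Lemma norm_dot_le u v : `|dot u v| <= enorm u * enorm v.
Proof.
rewrite -ler_sqr ?nnegrE ?mulr_ge0 ?enorm_ge0// real_normK ?num_real// exprMn !enorm_sqr.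
exact: (psd_CauchySchwarz dotPl dotC dot_ge0).
Qed.

Lemma dot_le u v : dot u v <= enorm u * enorm v.
Proof. exact: le_trans (ler_norm _) (norm_dot_le u v). Qed.

Lemma enormD u v : enorm (u + v) <= enorm u + enorm v.
Proof.
apply: enorm_le; first by rewrite addr_ge0 ?enorm_ge0.
rewrite dotDl !dotDr (dotC v u) -!enorm_sqr.
have := dot_le u v; nra.
Qed.

Lemma enormZ a u : enorm (a *: u) = `|a| * enorm u.
Proof.
apply/eqP; rewrite -(@eqrXn2 _ 2)// ?mulr_ge0 ?enorm_ge0//.
by rewrite exprMn !enorm_sqr dotZl dotZr real_normK ?num_real// mulrA.
Qed.

Lemma enormN u : enorm (- u) = enorm u.
Proof. by rewrite -scaleN1r enormZ normrN1 mul1r. Qed.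

Lemma enormB u v : enorm (u - v) = enorm (v - u).
Proof. by rewrite -enormN opprB. Qed.

Lemma enorm0 : enorm (0 : 'rV[R]_d) = 0.
Proof. by rewrite -(scale0r 0) enormZ normr0 mul0r. Qed.

Lemma enorm_eq0 u : enorm u = 0 -> u = 0.
Proof.
move=> u0; have : dot u u = 0 by rewrite -enorm_sqr u0 expr0n.
move=> /psumr_eq0P h; apply/rowP => i; rewrite mxE.
by apply/eqP; rewrite -sqrf_eq0 expr2 h// => j _; rewrite -expr2 sqr_ge0.
Qed.

Lemma coord_le_enorm u i : `|u ord0 i| <= enorm u.
Proof.
rewrite -ler_sqr ?nnegrE ?enorm_ge0// enorm_sqr real_normK ?num_real//.
by rewrite /dot (bigD1 i)//= -expr2 lerDl sumr_ge0// => j _; rewrite -expr2 sqr_ge0.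
Qed.

Lemma norm_le_enorm u : `|u| <= enorm u.
Proof.
rewrite /Num.norm/= mx_normrE; apply: bigmax_le => [|[i j] _]/=; first exact: enorm_ge0.
by rewrite (ord1 i) coord_le_enorm.
Qed.

Lemma enorm_le_coord u a : 0 <= a -> (forall i, `|u ord0 i| <= a) -> enorm u <= d%:R * a.
Proof.
move=> a0 ua; apply: enorm_le; first by rewrite mulr_ge0.
apply: (@le_trans _ _ (\sum_(i < d) a ^+ 2)).
  apply: ler_sum => i _; rewrite -expr2 -[leLHS]real_normK ?num_real//.
  by rewrite ler_sqr ?nnegrE.
rewrite sumr_const card_ord exprMn -[leLHS]mulr_natl ler_wpM2r ?sqr_ge0//.
by rewrite -natrX ler_nat; case: (d) => // k; rewrite leq_pmulr.
Qed.

Lemma coord_le_norm u i : `|u ord0 i| <= `|u|.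
Proof.
rewrite {2}/Num.norm/= mx_normrE.
by apply: (le_bigmax_cond _ (fun k => `|u k.1 k.2|) (j := (ord0, i))).
Qed.

Lemma enorm_le_norm u : enorm u <= d%:R * `|u|.
Proof. by apply: enorm_le_coord => // i; exact: coord_le_norm. Qed.

Lemma enorm_delta_le1 j : enorm (delta_mx ord0 j : 'rV[R]_d) <= 1.
Proof.
apply: enorm_le => //.
rewrite /dot (bigD1 j)//= big1 ?addr0 ?mxE ?eqxx ?mulr1 ?expr1n// => i /negPf ij.
by rewrite mxE ij mulr0.
Qed.

Lemma enorm_dist u v w : enorm (u - w) <= enorm (u - v) + enorm (v - w).
Proof. by rewrite -(subrKA v) enormD. Qed.

Lemma enorm_perturbed_step a u v w c : 0 <= a ->
  enorm (u - a *: v - c) <= enorm (u - a *: w - c) + a * enorm (v - w).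
Proof.
move=> a0.
have -> : u - a *: v - c = (u - a *: w - c) + (- a) *: (v - w).
  by rewrite scaleNr scalerBr opprB [u - a *: w - c]addrAC subrKA addrAC.
by rewrite (le_trans (enormD _ _))// enormZ normrN ger0_norm.
Qed.

(* [H] being symmetric, [H^2 <= L H] in the order of forms. *)
Lemma gd_form_contraction (H : 'rV[R]_d -> 'rV[R]_d) (L mu a : R)
    (Hsym : forall u v, dot u (H v) = dot v (H u))
    (HL : forall u, dot u (H u) <= L * dot u u)
    (mu0 : 0 <= mu) (Hmu : forall u, mu * dot u u <= dot u (H u))
    (a0 : 0 < a) (aL : a * L < 1) u :
  dot (u - a *: H u) (u - a *: H u) <= (1 - a * mu) * dot u u.
Proof.
have Hpsd v : 0 <= dot v (H v) by apply: le_trans (Hmu v); rewrite mulr_ge0 ?dot_ge0.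
(* Cauchy-Schwarz for the form of [H] at [u] and [H u]; bounding the last factor by [HL] leaves one
   power of [|H u|^2] to cancel. *)
have CS : dot (H u) (H u) ^+ 2 <= dot u (H u) * dot (H u) (H (H u)).
  rewrite [X in X ^+ 2]Hsym.
  have BC := @psd_CauchySchwarz _ _ (fun v w => dot v (H w)).
  by apply: BC => // *; exact: dotPl.
have HH : dot (H u) (H u) <= L * dot u (H u).
  (* [L] carries no sign hypothesis: [HL] makes it nonnegative as soon as there is a nonzero
     vector. *)
  have [->|Hu0] := eqVneq (dot (H u) (H u)) 0.
    have [uu0|uu0] := eqVneq (dot u u) 0.
      suff -> : dot u (H u) = 0 by rewrite mulr0.
      by apply/le_anti; rewrite Hpsd andbT (le_trans (HL u))// uu0 mulr0.
    have uu : 0 < dot u u by rewrite lt_def uu0 dot_ge0.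
    by rewrite mulr_ge0//; have := HL u; have := Hpsd u; nra.
  have Hu : 0 < dot (H u) (H u) by rewrite lt_def Hu0 dot_ge0.
  rewrite -(ler_pM2l Hu) -expr2 (le_trans CS)//.
  by have := HL (H u); have := Hpsd u; nra.
rewrite dot_gd_step.
(* Half of the first-order decrease [2 a <u, H u>] pays for the second-order term, and the other
   half gives the factor [1 - a mu]. *)
have aHH : a * a * dot (H u) (H u) <= a * dot u (H u).
  rewrite -mulrA ler_pM2l// (le_trans (ler_wpM2l (ltW a0) HH))// mulrA.
  by rewrite ler_piMl// ltW.
have := ler_wpM2l (ltW a0) (Hmu u); rewrite !(mulrDl, mulrDr); lra.
Qed.

End Euclid.

(** * Differential calculus *)

Lemma is_diff_derive (R : realType) (V W : normedModType R) (f df : V -> W) (x v : V) :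
  is_diff x f df -> 'D_v f x = df v.
Proof. by case=> dfx <-; rewrite deriveE. Qed.

Lemma norm_le_dist (R : realType) (V : normedModType R) (x y : V) (e : R) :
  `|x - y| <= e -> `|y| <= `|x| + e.
Proof. by move=> xy; rewrite -lerBlDl (le_trans (lerB_dist _ _))// distrC. Qed.

Lemma ball_segment (R : realType) (V : normedModType R) (p q q' : V) (r t : R) :
  `|q - p| < r -> `|q' - p| < r -> 0 <= t <= 1 -> `|q' + t *: (q - q') - p| < r.
Proof.
move=> Hq Hq' /andP[t0 t1].
have -> : q' + t *: (q - q') - p = (1 - t) *: (q' - p) + t *: (q - p).
  by rewrite scalerBl scale1r -[RHS]addrA -scalerN -scalerDr opprB [p - q' + _]addrC subrKA addrAC.
rewrite (le_lt_trans (ler_normD _ _))// !normrZ !ger0_norm// ?subr_ge0//.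
by move: t0; rewrite le_eqVlt => /orP[/eqP<-|t0]; nra.
Qed.

Lemma is_derive_line (R : realType) (V W : normedModType R) (h : V -> W) (p v : V) (t : R) :
  differentiable h (p + t *: v) ->
  is_derive t 1 (fun s : R => h (p + s *: v)) ('d h (p + t *: v) v).
Proof.
move=> dh.
have E : (fun s : R => s^-1 *: (h (p + (s *: (1 : R) + t) *: v) - h (p + t *: v))) =
    (fun s => s^-1 *: (h (s *: v + (p + t *: v)) - h (p + t *: v))).
  by apply/funext => s; rewrite [_ *: 1]mulr1 scalerDl addrCA.
apply: DeriveDef.
  by have := @diff_derivable _ _ _ _ _ v dh; rewrite /derivable -E.
by rewrite -deriveE// /derive -E.
Qed.

Lemma MVT_line (R : realType) (V : normedModType R) (h : V -> R) (p v : V) :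
  (forall t : R, 0 <= t <= 1 -> differentiable h (p + t *: v)) ->
  exists2 t : R, 0 <= t <= 1 & h (p + v) - h p = 'd h (p + t *: v) v.
Proof.
move=> dh.
pose c (s : R) := h (p + s *: v).
have dc (t : R) : 0 <= t <= 1 -> is_derive t 1 c ('d h (p + t *: v) v).
  by move=> t01; apply: is_derive_line; exact: dh.
have [| |t] := @MVT_segment _ c (fun t => 'd h (p + t *: v) v) 0 1 ler01.
- by move=> t /andP[t0 t1]; apply: dc; rewrite !ltW.
- apply: derivable_within_continuous => t.
  by rewrite in_itv/= => t01; case: (dc t t01).
- by rewrite in_itv/= subr0 mulr1 /c scale1r scale0r addr0 => t01 ->; exists t.
Qed.

(* Both mixed derivatives are the limit of the same second difference
   [h (p + t a + t b) - h (p + t a) - h (p + t b) + h p], divided by [t^2]. *)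
Lemma Schwarz (R : realType) (V : normedModType R) (h : V -> R)
    (dh : forall q, differentiable h q)
    (ddh : forall a q, differentiable (fun q => 'd h q a) q)
    (cddh : forall a b, continuous (fun q => 'd (fun q => 'd h q a) q b)) (p a b : V) :
  'd (fun q => 'd h q a) p b = 'd (fun q => 'd h q b) p a.
Proof.
(* The mean value theorem is applied to the increment [k] along [a'], then to the derivative in
   direction [a'] along [b']. The second difference is symmetric, so exchanging [a'] and [b'] gives
   an exact equality of two intermediate derivatives, and no limit has to be taken. *)
have key a' b' (t : R) : 0 < t -> exists2 r : R * R, (0 <= r.1 <= t) && (0 <= r.2 <= t) &
    h (p + t *: a' + t *: b') - h (p + t *: a') - h (p + t *: b') + h p =
    t ^+ 2 * 'd (fun q => 'd h q a') (p + (r.1 *: a' + r.2 *: b')) b'.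
  move=> t0; pose k q := h (q + t *: b') - h q.
  have dsh q : is_diff q (fun q => h (q + t *: b')) ('d h (q + t *: b')).
    have d1 : is_diff q (fun q => q + t *: b') id.
      have -> : (fun q => q + t *: b') = (id : V -> V) + cst (t *: b') by [].
      by apply: is_diff_eq; rewrite addr0.
    exact: (is_diff_comp d1 (differentiableP (dh (q + t *: b')))).
  have dk q : is_diff q k (('d h (q + t *: b') : V -> R) - ('d h q : V -> R)).
    by apply: is_diffB; exact: differentiableP.
  have [s s01 ks] : exists2 s : R, 0 <= s <= 1 &
      k (p + t *: a') - k p = 'd k (p + s *: (t *: a')) (t *: a').
    by apply: MVT_line => s _; case: (dk (p + s *: (t *: a'))).
  set q := p + s *: (t *: a') in ks.
  have [r r01 kr] : exists2 r : R, 0 <= r <= 1 &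
     'd h (q + t *: b') a' - 'd h q a' =
      'd (fun q => 'd h q a') (q + r *: (t *: b')) (t *: b').
    exact: MVT_line.
  exists (s * t, r * t).
    case/andP: s01 => s0 s1; case/andP: r01 => r0 r1.
    by rewrite /= !mulr_ge0 ?ler_piMl// ltW.
  transitivity (k (p + t *: a') - k p); first by rewrite /k; ring.
  rewrite ks linearZ/= diff_val/=. rewrite [X in _ *: X]kr linearZ/=.
  by rewrite /q !scalerA -addrA expr2.
suff h2 e : 0 < e -> `|'d (fun q => 'd h q a) p b - 'd (fun q => 'd h q b) p a| <= e + e.
  apply/eqP; rewrite -subr_eq0 -normr_le0; apply/ler_addgt0Pl => e e0.
  by rewrite addr0 (splitr e); apply: h2; rewrite divr_gt0.
move=> e0.
have := cddh a b p; move=> /cvgrPdist_le/(_ e e0)/nbhs_ballP[r1 /= r10 H1].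
have := cddh b a p; move=> /cvgrPdist_le/(_ e e0)/nbhs_ballP[r2 /= r20 H2].
pose M := `|a| + `|b| + 1.
have M0 : 0 < M by rewrite ltr_wpDl// addr_ge0.
(* Small enough for every intermediate point to lie in both continuity balls; the [+ 1] in [M]
   covers [a = b = 0]. *)
pose t := Num.min r1 r2 / M / 2.
have t0 : 0 < t by rewrite !divr_gt0// lt_min r10.
have tM : t * M < Num.min r1 r2.
  rewrite /t mulrAC divfK ?gt_eqF//.
  by rewrite ltr_pdivrMr// ltr_pMr ?ltr1n// lt_min r10.
have inb (x y : R) : (0 <= x <= t) && (0 <= y <= t) ->
    `|x *: a + y *: b| < Num.min r1 r2.
  move=> /andP[/andP[x0 xt] /andP[y0 yt]]; apply: le_lt_trans tM.
  rewrite (le_trans (ler_normD _ _))// !normrZ !ger0_norm//.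
  have := normr_ge0 a; have := normr_ge0 b; rewrite /M; nra.
have [[x y] xy E1] := key a b t t0.
have [[x' y'] xy' E2] := key b a t t0.
have E : 'd (fun q => 'd h q a) (p + (x *: a + y *: b)) b =
    'd (fun q => 'd h q b) (p + (x' *: b + y' *: a)) a.
  have t2 : t ^+ 2 != 0 by rewrite sqrf_eq0 gt_eqF.
  apply: (mulfI t2); rewrite -E1 -E2 (addrAC p); ring.
have := inb _ _ xy; rewrite lt_min => /andP[xy1 _].
have := inb y' x'; rewrite andbC => /(_ xy'); rewrite lt_min addrC => /andP[_ xy2].
have B1 := H1 (p + (x *: a + y *: b)).
have B2 := H2 (p + (x' *: b + y' *: a)).
rewrite -(subrKA ('d (fun q => 'd h q a) (p + (x *: a + y *: b)) b)).
rewrite (le_trans (ler_normD _ _))// lerD//.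
  by apply: B1; rewrite -ball_normE /ball_/= opprD addNKr normrN.
rewrite E distrC; apply: B2; by rewrite -ball_normE /ball_/= opprD addNKr normrN.
Qed.

Section PartialDerivatives.
Context {R : realType} {U V W : normedModType R}.

Lemma derive_pairl (h : U * V -> W) (x : U) (z : V) (u : U) :
  differentiable h (x, z) -> 'D_u (fun x => h (x, z)) x = 'd h (x, z) (u, 0).
Proof.
move=> dh.
have E : (fun s : R => s^-1 *: (h (s *: u + x, z) - h (x, z))) =
    (fun s => s^-1 *: (h (s *: (u, 0) + (x, z)) - h (x, z))).
  by apply/funext => s; rewrite -[s *: (u, 0) + _]/(s *: u + x, s *: 0 + z) scaler0 add0r.
transitivity ('D_(u, 0) h (x, z)); last exact: deriveE.
by rewrite /derive -E.
Qed.

Lemma derive_pairr (h : U * V -> W) (x : U) (z : V) (v : V) :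
  differentiable h (x, z) -> 'D_v (fun z => h (x, z)) z = 'd h (x, z) (0, v).
Proof.
move=> dh.
have E : (fun s : R => s^-1 *: (h (x, s *: v + z) - h (x, z))) =
    (fun s => s^-1 *: (h (s *: (0, v) + (x, z)) - h (x, z))).
  by apply/funext => s; rewrite -[s *: (0, v) + _]/(s *: 0 + x, s *: v + z) scaler0 add0r.
transitivity ('D_(0, v) h (x, z)); last exact: deriveE.
by rewrite /derive -E.
Qed.

End PartialDerivatives.

Lemma linear_row_sum (R : realType) (d : nat) (f : {linear 'rV[R]_d -> R}) (w : 'rV[R]_d) :
  f w = \sum_(j < d) w ord0 j * f (delta_mx ord0 j).
Proof.
by rewrite {1}(row_sum_delta w) linear_sum; apply: eq_bigr => j _; exact: linearZ.
Qed.

(** * Families of linear forms on a product and their local bounds *)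

Section LinearFamilies.
Context {R : realType} {n m : nat}.
Local Notation V := ('rV[R]_n * 'rV[R]_m)%type.

Lemma pair_sum_delta (v : V) :
  v = \sum_(i < n) v.1 ord0 i *: (delta_mx ord0 i, 0) +
      \sum_(j < m) v.2 ord0 j *: (0, delta_mx ord0 j).
Proof.
case: v => v1 v2 /=.
have -> : \sum_(i < n) v1 ord0 i *: ((delta_mx ord0 i, 0) : V) = (v1, 0).
  rewrite [in RHS](row_sum_delta v1) (big_morph (fun x => (x, 0) : V) (id1 := 0) (op1 := +%R))//.
    by apply: eq_bigr => i _; rewrite -[LHS]/(_ *: _, v1 ord0 i *: 0) scaler0.
  by move=> x y; rewrite -[RHS]/(x + y, 0 + 0) addr0.
have -> : \sum_(j < m) v2 ord0 j *: ((0, delta_mx ord0 j) : V) = (0, v2).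
  rewrite [in RHS](row_sum_delta v2) (big_morph (fun x => (0, x) : V) (id1 := 0) (op1 := +%R))//.
    by apply: eq_bigr => j _; rewrite -[LHS]/(v2 ord0 j *: 0, _ *: _) scaler0.
  by move=> x y; rewrite -[RHS]/(0 + 0, x + y) addr0.
by rewrite -[RHS]/(v1 + 0, 0 + v2) addr0 add0r.
Qed.

Lemma pair_line_snd (x : 'rV[R]_n) (z w : 'rV[R]_m) (t : R) :
  (x, z) + t *: (0, w) = (x, z + t *: w) :> V.
Proof. by rewrite -[LHS]/(x + t *: 0, z + t *: w) scaler0 addr0. Qed.

Lemma linear_pairr_sum (f : {linear V -> R}) (w : 'rV[R]_m) :
  f (0, w) = \sum_(j < m) w ord0 j * f (0, delta_mx ord0 j).
Proof.
rewrite {1}(pair_sum_delta (0, w)) linearD !linear_sum/= big1 ?add0r => [|i _].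
  by apply: eq_bigr => j _; exact: linearZ.
by rewrite mxE scale0r linear0.
Qed.

Lemma norm_pair_lt (x x' : 'rV[R]_n) (z z' : 'rV[R]_m) (r : R) :
  `|x - x'| < r -> `|z - z'| < r -> `|(x, z) - (x', z') : V| < r.
Proof. by move=> xr zr; rewrite prod_normE/= gt_max xr. Qed.

Lemma norm_snd_le_enorm (w : 'rV[R]_m) : `|(0, w) : V| <= enorm w.
Proof. by rewrite prod_normE/= normr0 ge_max enorm_ge0 norm_le_enorm. Qed.

Lemma norm_pairl (v : V) : `|v.1| <= `|v|.
Proof. by rewrite [leRHS]prod_normE le_max lexx. Qed.

Lemma norm_pairr (v : V) : `|v.2| <= `|v|.
Proof. by rewrite [leRHS]prod_normE le_max lexx orbT. Qed.

Lemma linear_pair_le (f : {linear V -> R}) (v : V) :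
  `|f v| <= (\sum_i `|f (delta_mx ord0 i, 0)| + \sum_j `|f (0, delta_mx ord0 j)|) * `|v|.
Proof.
rewrite {1}(pair_sum_delta v) linearD !linear_sum.
rewrite (le_trans (ler_normD _ _))// mulrDl lerD//.
  rewrite (le_trans (ler_norm_sum _ _ _))// mulr_suml ler_sum// => j _.
  rewrite linearZ [`|_ *: _|]normrM mulrC ler_wpM2l//.
  by rewrite (le_trans _ (norm_pairl v))// coord_le_norm.
rewrite (le_trans (ler_norm_sum _ _ _))// mulr_suml ler_sum// => j _.
rewrite linearZ [`|_ *: _|]normrM mulrC ler_wpM2l//.
by rewrite (le_trans _ (norm_pairr v))// coord_le_norm.
Qed.

(* Uniform boundedness: a pointwise bound can be taken on a basis. *)
Lemma near_linear_bound (T : Type) (F : set_system T) {FF : Filter F}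
    (l : T -> V -> R) (c : T -> R) :
  (forall i, linear (l i)) -> (forall i, 0 <= c i) ->
  (forall v, exists K, \forall i \near F, `|l i v| <= K * c i) ->
  exists2 K, 0 <= K & \forall i \near F, forall v, `|l i v| <= K * `|v| * c i.
Proof.
move=> llin c0 lb.
have /choice[K1 HK1] (i : 'I_n) := lb (delta_mx ord0 i, 0).
have /choice[K2 HK2] (j : 'I_m) := lb (0, delta_mx ord0 j).
exists (\sum_i `|K1 i| + \sum_j `|K2 j|); first by rewrite addr_ge0 ?sumr_ge0.
near=> i => v.
have N1 : forall j, `|l i (delta_mx ord0 j, 0)| <= K1 j * c i.
  by near: i; apply: filter_forall.
have N2 : forall j, `|l i (0, delta_mx ord0 j)| <= K2 j * c i.
  by near: i; apply: filter_forall.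
pose lM := GRing.isLinear.Build _ _ _ _ _ (llin i).
pose L : {linear V -> R} := HB.pack (l i) lM.
apply: le_trans (linear_pair_le L v) _.
rewrite mulrAC ler_wpM2r// mulrDl !mulr_suml lerD// ler_sum// => j _.
  by rewrite (le_trans (N1 j))// ler_wpM2r// ler_norm.
by rewrite (le_trans (N2 j))// ler_wpM2r// ler_norm.
Unshelve. all: by end_near. Qed.

(** [near_linear_bound] is used twice. With weight 1 it bounds the derivative of [h^~ v] near [p],
    and the mean value theorem yields a Lipschitz constant that depends on [v]. With weight
    [|q - q'|], applied to the differences [h q - h q'], it makes this constant uniform in [v]. *)
Lemma near_linear_lipschitz (h : V -> V -> R) (p : V) :
  (forall q, linear (h q)) ->
  (forall v q, differentiable (h^~ v) q) ->
  (forall v w, continuous (fun q => 'd (h^~ v) q w)) ->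
  exists r K, [/\ 0 < r, 0 <= K & forall q q', `|q - p| < r -> `|q' - p| < r ->
    forall v, `|h q v - h q' v| <= K * `|v| * `|q - q'|].
Proof.
move=> hlin dh cdh.
have lip v : exists K, \forall qq \near (p, p),
    `|h qq.1 v - h qq.2 v| <= K * `|qq.1 - qq.2|.
  have [| |w|K K0 HK] := @near_linear_bound V (nbhs p) _ (fun q => 'd (h^~ v) q) (cst 1).
  - by move=> q a u w; rewrite linearP.
  - by [].
  - exists (`|'d (h^~ v) p w| + 1).
    have := cdh v w p => /cvgrPdist_le/(_ 1 ltr01); apply: filterS => q Hq.
    rewrite [_ * _]mulr1; exact: norm_le_dist.
  have /nbhs_ballP[r /= r0 Hr] := HK.
  exists K; apply/nbhs_ballP; exists r => //= -[q q'] [/= Hq Hq'].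
  have [t t01] : exists2 t : R, 0 <= t <= 1 &
      h (q' + (q - q')) v - h q' v = 'd (h^~ v) (q' + t *: (q - q')) (q - q').
    exact: (@MVT_line _ _ (h^~ v)).
  rewrite (addrC q') subrK => ->.
  have {}Hr x : ball p r x -> `|'d (h^~ v) x (q - q')| <= K * `|q - q'|.
    by move=> /Hr/(_ (q - q')); rewrite [leRHS]mulr1.
  apply: Hr.
  move: Hq Hq'; rewrite -!ball_normE /ball_/= => Hq Hq'.
  by rewrite distrC ball_segment// distrC.
have [| |v|K K0 HK] := @near_linear_bound _ (nbhs (p, p)) _
    (fun qq v => h qq.1 v - h qq.2 v) (fun qq => `|qq.1 - qq.2|).
- by move=> q a u w; rewrite !hlin scalerBr opprD addrACA.
- by [].
- exact: lip.
have /nbhs_ballP[r /= r0 Hr] := HK.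
exists r, K; split => // q q' Hq Hq'.
apply: (Hr (q, q')); split; rewrite -ball_normE /ball_/= distrC//.
Qed.

End LinearFamilies.

Lemma is_diff_row (R : realType) (V : normedModType R) (d : nat)
    (h dh : 'I_d -> V -> R) (p : V) :
  (forall i, is_diff p (h i) (dh i)) ->
  is_diff p (fun q => \row_i h i q) (fun v => \row_i dh i v).
Proof.
move=> hd.
have df : differentiable (fun q => \row_i h i q) p.
  have -> : (fun q => \row_i h i q) =
      \sum_i (fun q => h i q *: (delta_mx ord0 i : 'rV[R]_d)).
    apply/funext => q; rewrite [LHS]row_sum_delta fct_sumE.
    by apply: eq_bigr => i _; rewrite mxE.
  apply: differentiable_sum => i; apply: differentiableZl.
  by case: (hd i).
apply: DiffDef => //; apply/funext => v.
rewrite -deriveE// derive_mx; last exact: diff_derivable.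
apply/rowP => i; rewrite !mxE.
have -> : (fun t => (\row_i h i t) ord0 i) = h i by apply/funext => t; rewrite mxE.
by rewrite deriveE ?diff_val//; case: (hd i).
Qed.

(** * The lower-level gradient map and its contraction *)

Section LowerLevel.
Context {R : realType} {n m : nat}.
Local Notation V := ('rV[R]_n * 'rV[R]_m)%type.
Context (g : V -> R) (hg : Ck_on 3 setT g).

Let dg q : differentiable g q.
Proof. by case: hg => H _; exact: H. Qed.

Let ddg a q : differentiable (fun q => 'd g q a) q.
Proof. by case: hg => _ /(_ a)[H _]; exact: H. Qed.

Let dddg a b q : differentiable (fun q => 'd (fun q => 'd g q a) q b) q.
Proof. by case: hg => _ /(_ a)[_ /(_ b)[H _]]; exact: H. Qed.

Let cdddg a b c : continuous (fun q => 'd (fun q => 'd (fun q => 'd g q a) q b) q c).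
Proof. by move=> q; case: hg => _ /(_ a)[_ /(_ b)[_ /(_ c)]]; exact. Qed.

Let cddg a b : continuous (fun q => 'd (fun q => 'd g q a) q b).
Proof. by move=> q; exact: (differentiable_continuous (dddg a b q)). Qed.

Let sym p a b : 'd (fun q => 'd g q a) p b = 'd (fun q => 'd g q b) p a.
Proof. exact: (Schwarz dg ddg cddg p a b). Qed.

(** The differential of [grad_y g] in both variables, as [is_diff_grad_y] shows; this form exposes
    the second derivatives to which Schwarz symmetry applies. *)
Definition dgrad_y (q v : V) : 'rV[R]_m :=
  \row_i 'd (fun q => 'd g q (0, delta_mx ord0 i)) q v.

Lemma dgrad_y_linear q : linear (dgrad_y q).
Proof. by move=> a u v; apply/rowP => i; rewrite 4!mxE [dgrad_y _ _ _ _]mxE; exact: linearP. Qed.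

Lemma grad_yE x z : grad_y g x z = \row_i 'd g (x, z) (0, delta_mx ord0 i).
Proof. by apply/rowP => i; rewrite !mxE derive_pairr. Qed.

Lemma dot_grad_y x z w : dot w (grad_y g x z) = 'd g (x, z) (0, w).
Proof.
by rewrite grad_yE [RHS]linear_pairr_sum; apply: eq_bigr => i _; rewrite mxE.
Qed.

Lemma is_diff_grad_y q : is_diff q (fun q => grad_y g q.1 q.2) (dgrad_y q).
Proof.
have -> : (fun q => grad_y g q.1 q.2) = (fun q => \row_i 'd g q (0, delta_mx ord0 i)).
  by apply/funext => -[x z]; rewrite grad_yE.
by apply: is_diff_row => i; exact: differentiableP.
Qed.

(** Symmetry moves [(0, w)] from the inner direction to the outer one, in which a differential is
    linear and expands over the basis. *)
Lemma dot_dgrad_y q w v : dot w (dgrad_y q v) = 'd (fun q => 'd g q (0, w)) q v.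
Proof.
rewrite sym [RHS]linear_pairr_sum; apply: eq_bigr => i _.
by rewrite mxE; congr (_ * _); exact: sym.
Qed.

Lemma hess_y_dgrad_y x z v :
  (v *m hess (fun z => g (x, z)) z *m v^T) ord0 ord0 = dot v (dgrad_y (x, z) (0, v)).
Proof.
rewrite mxE dotC; apply: eq_bigr => i _; rewrite mxE [in RHS]mxE mxE; congr (_ * _).
rewrite [RHS]linear_pairr_sum; apply: eq_bigr => j _; rewrite mxE; congr (_ * _).
have -> : (fun w => 'D_(delta_mx ord0 i) (fun z => g (x, z)) w) =
    (fun w => 'd g (x, w) (0, delta_mx ord0 i)).
  by apply/funext => w; rewrite derive_pairr.
exact: (derive_pairr (h := fun q => 'd g q (0, delta_mx ord0 i))).
Qed.

Lemma dot_dgrad_y_sym q u v : dot u (dgrad_y q (0, v)) = dot v (dgrad_y q (0, u)).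
Proof. by rewrite !dot_dgrad_y; exact: sym. Qed.

Lemma dgrad_y_lipschitz_near (p : V) : exists r K, [/\ 0 < r, 0 <= K &
  forall q q', `|q - p| < r -> `|q' - p| < r ->
    forall v, enorm (dgrad_y q v - dgrad_y q' v) <= K * `|v| * `|q - q'| ].
Proof.
have /choice[r /choice[K HK]] (i : 'I_m) := @near_linear_lipschitz _ n m
  (fun q v => 'd (fun q => 'd g q (0, delta_mx ord0 i)) q v) p (fun q a u v => linearP _ _ _ _)
  (fun v q => dddg _ v q) (fun v w => @cdddg _ v w).
exists (\big[Order.min/1]_i r i), (m%:R * \sum_i K i).
have K0 : 0 <= \sum_i K i by apply: sumr_ge0 => i _; case: (HK i).
split.
- by apply: lt_bigmin => // i _; case: (HK i).
- by rewrite mulr_ge0.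
- move=> q q' qp qp' v; rewrite -!mulrA; apply: enorm_le_coord => [|i].
    by rewrite mulr_ge0// mulr_ge0.
  have [_ Ki0 lip] := HK i.
  rewrite !mxE (le_trans (lip q q' _ _ v))//.
  - by rewrite (lt_le_trans qp)// bigmin_le_cond.
  - by rewrite (lt_le_trans qp')// bigmin_le_cond.
  rewrite -mulrA ler_wpM2r ?mulr_ge0//.
  by rewrite (bigD1 i)//= lerDl sumr_ge0// => j _; case: (HK j).
Qed.

End LowerLevel.

(** * Positive definite forms and the local contraction *)

Lemma quad_form_continuous (R : realType) (d : nat) (H : 'M[R]_d) :
  continuous (fun v : 'rV[R]_d => (v *m H *m v^T) ord0 ord0).
Proof.
have -> : (fun v : 'rV[R]_d => (v *m H *m v^T) ord0 ord0) =
    \sum_j \sum_i (fun v : 'rV[R]_d => v ord0 i * H i j * v ord0 j).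
  apply/funext => v; rewrite mxE fct_sumE; apply: eq_bigr => j _.
  by rewrite !mxE fct_sumE mulr_suml.
move=> v; apply: differentiable_continuous.
apply: differentiable_sum => j; apply: differentiable_sum => i.
apply: differentiableM; last exact: differentiable_coord.
apply: differentiableM; first exact: differentiable_coord.
exact: differentiable_cst.
Qed.

(** [mu] is the minimum of the form on the Euclidean unit sphere, which is compact; homogeneity
    extends the bound to all vectors. *)
Lemma posdefmx_lower_bound (R : realType) (d : nat) (H : 'M[R]_d) : posdefmx H ->
  exists2 mu, 0 < mu & forall v, mu * dot v v <= (v *m H *m v^T) ord0 ord0.
Proof.
move=> Hpos.
(* In dimension 0 the sphere is empty and any positive [mu] works. *)
have [[v0 v0n]|/forallNP Hn] := pselect (exists v : 'rV[R]_d, v != 0); last first.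
  exists 1 => // v; suff -> : v = 0.
    by rewrite dot0l mulr0 !mul0mx [leRHS]mxE.
  by apply/eqP; have /negP := Hn v; rewrite negbK.
pose S := [set v : 'rV[R]_d | enorm v = 1].
have normalize v : v != 0 -> S ((enorm v)^-1 *: v).
  move=> vn; have ve0 : enorm v != 0 by apply: contra_neq vn; exact: enorm_eq0.
  by rewrite /S/= enormZ ger0_norm ?invr_ge0 ?enorm_ge0// mulVf.
have cS : compact S.
  apply: bounded_closed_compact.
    exists 1; split => // M M1 v Sv.
    by apply: le_trans (norm_le_enorm v) _; rewrite Sv ltW.
  (* As a level set of the form of the identity matrix, the sphere is closed by
     [quad_form_continuous]. *)
  have -> : S = [set v : 'rV[R]_d | (v *m 1%:M *m v^T) ord0 ord0 = 1].
    apply/seteqP; split => v; rewrite /S/= mulmx1 mxE.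
      under eq_bigr do rewrite mxE; rewrite -/(dot v v) -enorm_sqr => ->.
      by rewrite expr1n.
    under eq_bigr do rewrite mxE; rewrite -/(dot v v) -enorm_sqr => /eqP.
    by rewrite sqrf_eq1 => /orP[/eqP->//|/eqP v1]; have := enorm_ge0 v; rewrite v1; lra.
  apply: preimage_closed (@closed_eq _ 1) => v _; exact: quad_form_continuous.
have S0 : S !=set0 by exists ((enorm v0)^-1 *: v0); exact: normalize.
have [|c cS1 cmin] := EVT_min_rV S0 cS (f := fun v => (v *m H *m v^T) ord0 ord0).
  by apply: continuous_subspaceT; exact: quad_form_continuous.
rewrite inE in cS1.
exists ((c *m H *m c^T) ord0 ord0).
  by apply: Hpos; apply/eqP => c0; move: cS1; rewrite c0 /S/= enorm0; lra.
move=> v; have [->|vn] := eqVneq v 0.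
  by rewrite dot0l mulr0 !mul0mx [leRHS]mxE.
have v0' : enorm v != 0 by apply: contra_neq vn; exact: enorm_eq0.
have := cmin ((enorm v)^-1 *: v) (mem_set (normalize v vn)).
rewrite linearZ/= -!scalemxAl -scalemxAr scalerA [leRHS]mxE.
rewrite -expr2 exprVn ler_pdivlMl ?exprn_gt0 ?lt_def ?v0' ?enorm_ge0//.
by rewrite enorm_sqr mulrC.
Qed.

Section Contraction.
Context {R : realType} {n m : nat}.
Local Notation V := ('rV[R]_n * 'rV[R]_m)%type.
Context (g : V -> R) (hg : Ck_on 3 setT g) (L alpha : R).
Context (glip : forall x, lipschitz_grad L (fun y => g (x, y))).

(** The left side is the limit of the difference quotients of [dot w (grad_y g x (z + t *: w))] at
    [t = 0], and the Lipschitz bound with Cauchy-Schwarz caps each quotient by [L |w|^2]. *)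
Lemma dgrad_y_le x z w : dot w (dgrad_y g (x, z) (0, w)) <= L * dot w w.
Proof.
pose h t := dot w (grad_y g x (z + t *: w)).
have hE : h = fun t => 'd g ((x, z) + t *: (0, w)) (0, w).
  by apply/funext => t; rewrite pair_line_snd /h dot_grad_y.
have dh : is_derive (0:R) 1 h (dot w (dgrad_y g (x, z) (0, w))).
  rewrite dot_dgrad_y// hE.
  have := @is_derive_line _ _ _ (fun q => 'd g q (0, w)) (x, z) (0, w) 0.
  rewrite scale0r addr0; apply; by case: hg => _ /(_ (0, w))[H _]; exact: H.
case: dh => dh <-; apply: limr_le => //.
near=> t.
have t0 : t != 0 by near: t; exact: nbhs_dnbhs_neq.
rewrite /= (_ : t *: (1 : R) + 0 = t); last by rewrite addr0; exact: mulr1.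
rewrite /h scale0r addr0.
rewrite -dotBr.
apply: le_trans (ler_norm _) _; rewrite normrM normfV.
rewrite ler_pdivrMl ?normr_gt0// (le_trans (norm_dot_le _ _))//.
have := @glip x (z + t *: w) z; rewrite [_ + _ - z]addrAC subrr add0r enormZ -/(grad_y _ _ _) => H.
rewrite (le_trans (ler_wpM2l (enorm_ge0 w) H))// -enorm_sqr expr2; lra.
Unshelve. all: by end_near. Qed.

(* The two bounds hold on a common ball: the second one propagates to the ball
   the contraction that holds at the minimizer itself. *)
Lemma lower_gd_differential_near xs zs :
  0 < alpha -> alpha * L < 1 -> posdefmx (hess (fun z => g (xs, z)) zs) ->
  exists r K rho, [/\ 0 < r, 0 <= K, 0 < rho < 1,
    (forall q w, `|q - (xs, zs)| < r ->
      enorm (w - alpha *: dgrad_y g q (0, w)) <= rho * enorm w) &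
    (forall q q' v, `|q - (xs, zs)| < r -> `|q' - (xs, zs)| < r ->
      enorm (dgrad_y g q v - dgrad_y g q' v) <= K * `|v| * `|q - q'|)].
Proof.
move=> a0 aL /posdefmx_lower_bound[mu mu0 Hmu].
have [r1 [K [r10 K0 HK]]] := dgrad_y_lipschitz_near hg (xs, zs).
(* The maximum with 0 spares a comparison of [mu] with [L], which may fail in dimension 0. *)
pose rho0 := Num.sqrt (Num.max 0 (1 - alpha * mu)).
have rho01 : rho0 < 1.
  by rewrite -sqrtr1 ltr_sqrt// gt_max ltr01/= ltrBlDr ltrDl mulr_gt0.
have split_step (w b c : 'rV[R]_m) :
    w - alpha *: b = (w - alpha *: c) + (- alpha) *: (b - c).
  by rewrite scaleNr scalerBr opprB addrA subrK.
have contr w : enorm (w - alpha *: dgrad_y g (xs, zs) (0, w)) <= rho0 * enorm w.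
  apply: enorm_le; first by rewrite mulr_ge0 ?sqrtr_ge0 ?enorm_ge0.
  rewrite exprMn enorm_sqr sqr_sqrtr ?le_max ?lexx//.
  apply: (@le_trans _ _ ((1 - alpha * mu) * dot w w)); last first.
    by rewrite ler_wpM2r ?dot_ge0// le_max lexx orbT.
  apply: (gd_form_contraction (H := fun w => dgrad_y g (xs, zs) (0, w)) (L := L)) => //.
  - by move=> u v; exact: dot_dgrad_y_sym.
  - by move=> u; exact: dgrad_y_le.
  - exact: ltW.
  - by move=> u; rewrite -hess_y_dgrad_y.
(* The gap [rho - rho0] absorbs the change of [dgrad_y] over the ball: the radius chosen below makes
   [alpha K |q - p|] at most this gap. The midpoint is also positive when [rho0 = 0], and the [+ 1]
   in [c] allows [K = 0]. *)
pose rho := (rho0 + 1) / 2.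
have rho0_ge0 : 0 <= rho0 by exact: sqrtr_ge0.
pose c := alpha * K + 1.
have c0 : 0 < c by rewrite ltr_wpDl// mulr_ge0// ltW.
exists (Num.min r1 ((rho - rho0) / c)), K, rho.
have rr : 0 < rho - rho0 by rewrite /rho; lra.
split.
- by rewrite lt_min r10 divr_gt0.
- by [].
- by rewrite /rho; lra.
- move=> q w; rewrite lt_min => /andP[q1 q2].
  rewrite (split_step w _ (dgrad_y g (xs, zs) (0, w))).
  rewrite (le_trans (enormD _ _))// enormZ normrN gtr0_norm//.
  have H1 := HK q (xs, zs) q1; rewrite subrr normr0 in H1; have {}H1 := H1 r10 (0, w).
  have w0 : `|(0, w) : V| <= enorm w := norm_snd_le_enorm w.
  have -> : rho * enorm w = rho0 * enorm w + (rho - rho0) * enorm w by ring.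
  apply: lerD => //; rewrite (le_trans (ler_wpM2l (ltW a0) H1))//.
  move: q2; rewrite ltr_pdivlMr// /c => q2.
  rewrite -mulrA [`|_| * _]mulrC !mulrA ler_pM ?mulr_ge0//; first exact: ltW.
  by rewrite (le_trans _ (ltW q2))// mulrDr mulr1 [leRHS]addrC mulrC -lerBlDr subrr.
- move=> q q' v; rewrite !lt_min => /andP[q1 _] /andP[q1' _]; exact: HK.
Qed.
End Contraction.

(** * Iterates and their differentials *)

Section Projections.
Context {R : realType} {U V : normedModType R}.

Lemma is_diff_fst (p : U * V) : is_diff p (fst : U * V -> U) (fst : U * V -> U).
Proof.
have cf : continuous (fst : U * V -> U) by move=> q; exact: cvg_fst.
apply: DiffDef; first exact: linear_differentiable.
exact: diff_lin.
Qed.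

Lemma is_diff_snd (p : U * V) : is_diff p (snd : U * V -> V) (snd : U * V -> V).
Proof.
have cf : continuous (snd : U * V -> V) by move=> q; exact: cvg_snd.
apply: DiffDef; first exact: linear_differentiable.
exact: diff_lin.
Qed.

End Projections.

Section Orbit.
Context {R : realType} {n m : nat}.
Local Notation V := ('rV[R]_n * 'rV[R]_m)%type.
Context (g : V -> R) (hg : Ck_on 3 setT g) (alpha : R).

(** Keeping [x] as a component makes k lower-level steps an iterate of a single self-map, so one
    chain rule yields the derivatives in [x] and in [z] together. *)
Definition lower_gd_map (q : V) : V := (q.1, lower_gd g alpha q.1 q.2).

Definition lower_gd_tangent (q v : V) : V := (v.1, v.2 - alpha *: dgrad_y g q v).

Fixpoint iter_tangent (k : nat) (q v : V) : V :=
  if k is k'.+1 then lower_gd_tangent (iter k' lower_gd_map q) (iter_tangent k' q v)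
  else v.

Lemma iter_lower_gd_map k x z :
  iter k lower_gd_map (x, z) = (x, iter k (lower_gd g alpha x) z).
Proof. by elim: k => [//|k IH]; rewrite !iterS IH. Qed.

Lemma is_diff_lower_gd_map q : is_diff q lower_gd_map (lower_gd_tangent q).
Proof.
apply: is_diff_pair; first exact: is_diff_fst.
apply: is_diffB; first exact: is_diff_snd.
by apply: is_diffZ; exact: is_diff_grad_y.
Qed.

Lemma is_diff_iter k q : is_diff q (iter k lower_gd_map) (iter_tangent k q).
Proof.
elim: k => [|k IH] /=; first exact: is_diff_id.
exact: (is_diff_comp IH (is_diff_lower_gd_map _)).
Qed.

Lemma iter_tangent1 k q v : (iter_tangent k q v).1 = v.1.
Proof. by elim: k => //= k ->. Qed.

Context (p : V) (r rho K : R) (r0 : 0 < r) (rho01 : 0 < rho < 1) (K0 : 0 <= K)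
  (alpha0 : 0 < alpha).
Context (contr : forall q w, `|q - p| < r ->
  enorm (w - alpha *: dgrad_y g q (0, w)) <= rho * enorm w).
Context (lip : forall q q' v, `|q - p| < r -> `|q' - p| < r ->
  enorm (dgrad_y g q v - dgrad_y g q' v) <= K * `|v| * `|q - q'|).

(** The mean value equality fails for vector-valued maps, so it is applied to the scalar product
    with the difference [D] itself. Cauchy-Schwarz then bounds [|D|^2] by [|D| rho |z - z'|]. *)
Lemma lower_gd_contraction x z z' : `|(x, z) - p| < r -> `|(x, z') - p| < r ->
  enorm (lower_gd g alpha x z - lower_gd g alpha x z') <= rho * enorm (z - z').
Proof.
move=> zr z'r; set D := _ - _.
have [D0|D0] := eqVneq (enorm D) 0.
  by rewrite D0 mulr_ge0 ?enorm_ge0//; case/andP: rho01 => /ltW.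
have Dp : 0 < enorm D by rewrite lt_def D0 enorm_ge0.
pose h q := 'd g q (0, D).
have [t t01 ht] : exists2 t : R, 0 <= t <= 1 &
    h ((x, z') + (0, z - z')) - h (x, z') = 'd h ((x, z') + t *: (0, z - z')) (0, z - z').
  by apply: MVT_line => t _; case: hg => _ /(_ (0, D))[H _]; exact: H.
have z'E : (x, z') + (0, z - z') = (x, z) :> V.
  by rewrite -[(0, z - z')]scale1r pair_line_snd scale1r addrC subrK.
have {}ht : dot D (grad_y g x z - grad_y g x z') =
    dot D (dgrad_y g (x, z' + t *: (z - z')) (0, z - z')).
  rewrite dotBr !(dot_grad_y hg) (dot_dgrad_y hg) -[(x, z' + _)]pair_line_snd.
  by move: ht; rewrite z'E; exact.
rewrite -(ler_pM2l Dp) -expr2 enorm_sqr.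
have -> : dot D D = dot D (z - z' - alpha *: dgrad_y g (x, z' + t *: (z - z')) (0, z - z')).
  rewrite [RHS]dotBr dotZr -ht -dotZr -dotBr; congr dot.
  rewrite /D /lower_gd (opprD z') opprK addrACA scalerBr; congr (_ + _).
  by rewrite opprB addrC.
rewrite (le_trans (dot_le _ _))// ler_pM2l// contr//.
by rewrite -pair_line_snd; have := ball_segment zr z'r t01; rewrite -[(x, z) - _]/(x - x, z - z') subrr.
Qed.

Context (x : 'rV[R]_n) (z yx : 'rV[R]_m).
Context (xr : `|x - p.1| < r) (yx0 : grad_y g x yx = 0)
  (yxr : enorm (yx - p.2) < r / 4) (zr : enorm (z - p.2) < r / 4).
Let zk k := iter k (lower_gd g alpha x) z.

Let rho_ge0 : 0 <= rho. Proof. by case/andP: rho01 => /ltW. Qed.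

Lemma fixpoint_near : `|(x, yx) - p| < r.
Proof.
case: p xr yxr => p1 p2 /= xp yp; apply: norm_pair_lt => //.
by rewrite (le_lt_trans (norm_le_enorm _))// (lt_trans yp)//; move: r0; lra.
Qed.

Lemma init_dist : enorm (z - yx) <= r / 2.
Proof.
have := enorm_dist z p.2 yx; rewrite [enorm (p.2 - _)]enormB.
by move: yxr zr; lra.
Qed.

(** The contraction needs the orbit to stay in the ball, so both claims go together. Since [z] and
    [yx] are within [r / 4] of [p.2], their distance is at most [r / 2]; any point no farther from
    [yx] is within [3 r / 4] of [p.2]. *)
Lemma orbit_near_dist k :
  `|(x, zk k) - p| < r /\ enorm (zk k - yx) <= rho ^+ k * enorm (z - yx).
Proof.
have near_of_dist j : enorm (zk j - yx) <= rho ^+ j * enorm (z - yx) -> `|(x, zk j) - p| < r.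
  move=> dj; case: p xr yxr init_dist => p1 p2 /= xp yp id; apply: norm_pair_lt => //.
  rewrite (le_lt_trans (norm_le_enorm _))// (le_lt_trans (enorm_dist _ yx _))//.
  have rj : rho ^+ j <= 1 by rewrite exprn_ile1//; case/andP: rho01 => _ /ltW.
  have := ler_wpM2r (enorm_ge0 (z - yx)) rj; move: dj yp id r0; lra.
suff dk : enorm (zk k - yx) <= rho ^+ k * enorm (z - yx) by split=> //; exact: near_of_dist.
elim: k => [|k IH]; first by rewrite expr0 mul1r.
have fixyx : yx = lower_gd g alpha x yx by rewrite /lower_gd yx0 scaler0 subr0.
rewrite [zk _]iterS {1}fixyx (le_trans (lower_gd_contraction _ fixpoint_near))//.
  exact: near_of_dist.
by rewrite exprS -mulrA ler_wpM2l.
Qed.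

Lemma iter_near k : `|iter k lower_gd_map (x, z) - p| < r.
Proof. by rewrite iter_lower_gd_map; have [] := orbit_near_dist k. Qed.

Lemma iter_fixpoint_dist k : `|iter k lower_gd_map (x, z) - (x, yx)| <= rho ^+ k * r.
Proof.
have [_ dk] := orbit_near_dist k.
rewrite iter_lower_gd_map -/(zk k) -[_ - _]/(x - x, zk k - yx) subrr prod_normE/= normr0.
rewrite ge_max mulr_ge0 ?exprn_ge0 ?(ltW r0)//=.
rewrite (le_trans (norm_le_enorm _))// (le_trans dk)// ler_wpM2l ?exprn_ge0//.
by rewrite (le_trans init_dist)//; move: r0; lra.
Qed.

Lemma tangent_z_decay k w : enorm (iter_tangent k (x, z) (0, w)).2 <= rho ^+ k * enorm w.
Proof.
elim: k => [|k IH]; first by rewrite expr0 mul1r.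
set t := iter_tangent k (x, z) (0, w) in IH *.
have t1 : t.1 = 0 := iter_tangent1 k _ _.
have tE : t = (0, t.2) by rewrite {1}[t]surjective_pairing t1.
rewrite [iter_tangent _ _ _]/(lower_gd_tangent _ t) /lower_gd_tangent/= [in dgrad_y _ _ _]tE.
by rewrite (le_trans (contr _ (iter_near k)))// exprS -mulrA ler_wpM2l.
Qed.

(* [Y] is the derivative of the fixed point in the direction [u]; it is itself
   fixed by the tangent map at [(x, yx)]. *)
Lemma tangent_x_dist (u : 'rV[R]_n) (Y : 'rV[R]_m) (M C rho1 : R) k :
  dgrad_y g (x, yx) (u, Y) = 0 -> `|(u, Y) : V| <= M -> enorm Y <= C ->
  rho < rho1 -> alpha * K * M * r <= C * (rho1 - rho) ->
  enorm ((iter_tangent k (x, z) (u, 0)).2 - Y) <= C * rho1 ^+ k.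
Proof.
move=> Y0 uYM YC rho1r HC.
have rho1_ge0 : 0 <= rho1 := le_trans rho_ge0 (ltW rho1r).
elim: k => [|k IH]; first by rewrite expr0 mulr1/= sub0r enormN.
set t := iter_tangent k (x, z) (u, 0) in IH *.
have t1 : t.1 = u := iter_tangent1 k _ _.
have tE : t = (0, t.2 - Y) + (u, Y).
  by rewrite -[RHS]/(0 + u, t.2 - Y + Y) add0r subrK {1}[t]surjective_pairing t1.
rewrite [iter_tangent _ _ _]/(lower_gd_tangent _ t) /lower_gd_tangent/=.
set q := iter k _ _.
have qr : `|q - p| < r by exact: iter_near.
(* The error direction [(0, t.2 - Y)] is contracted, while [(u, Y)] is annihilated at the fixed
   point and contributes only the change of [dgrad_y] between [q] and [(x, yx)]. *)
have dE : dgrad_y g q t = dgrad_y g q (0, t.2 - Y) + (dgrad_y g q (u, Y) - dgrad_y g (x, yx) (u, Y)).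
  rewrite Y0 subr0 {1}tE; have := dgrad_y_linear g q 1 (0, t.2 - Y) (u, Y).
  by rewrite !scale1r.
have splitE (a b c : 'rV[R]_m) :
    a - alpha *: (b + c) - Y = (a - Y - alpha *: b) - alpha *: c.
  by rewrite scalerDr opprD addrA [LHS]addrAC; congr (_ - _); rewrite addrAC.
rewrite dE splitE.
rewrite (le_trans (enormD _ _))// enormN enormZ gtr0_norm//.
(* With [rho ^+ k] relaxed to [rho1 ^+ k], the driving term is at most
   [C * (rho1 - rho) * rho1 ^+ k], exactly what [rho * C * rho1 ^+ k] lacks to reach
   [C * rho1 ^+ k.+1]. *)
have qy : `|q - (x, yx)| <= rho1 ^+ k * r.
  rewrite (le_trans (iter_fixpoint_dist k))// ler_wpM2r ?(ltW r0)//.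
  by rewrite lerXn2r ?nnegrE// ltW.
have H1 := contr (t.2 - Y) qr.
have H2 := lip (u, Y) qr fixpoint_near.
have H3 : K * `|(u, Y) : V| * `|q - (x, yx)| <= K * M * (rho1 ^+ k * r).
  by rewrite ler_pM ?mulr_ge0// ler_wpM2l.
have rho1k : 0 <= rho1 ^+ k by rewrite exprn_ge0.
have H4 := ler_wpM2l (ltW alpha0) (le_trans H2 H3).
have H5 := ler_wpM2r rho1k HC.
have H6 := ler_wpM2l rho_ge0 IH.
rewrite exprS; apply: le_trans (lerD (le_trans H1 H6) H4) _.
rewrite -subr_ge0; rewrite -subr_ge0 in H5; apply: le_trans H5 _; rewrite le_eqVlt; apply/orP; left; apply/eqP.
ring.
Qed.

End Orbit.

(** * The upper-level gradient step *)

Lemma differentiable_estimate (R : realType) (V W : normedModType R) (f : V -> W)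
    (p : V) (e : R) : differentiable f p -> 0 < e ->
  exists2 r, 0 < r & forall q, `|q - p| < r ->
    `|f q - f p - 'd f p (q - p)| <= e * `|q - p|.
Proof.
move=> /diff_locally/eqaddoP/(_ e) H e0.
have /nbhs_ballP[r /= r0 Hr] := H e0.
exists r => // q qp.
have := Hr (q - p); rewrite -ball_normE /ball_/= sub0r normrN => /(_ qp).
by rewrite /= -[(_ - _) (q - p)]/(f (q - p + p) - (f p + 'd f p (q - p))) subrK opprD addrA.
Qed.

Lemma near_ball (R : realType) (V : normedModType R) (p : V) (P : V -> Prop) :
  (\forall q \near p, P q) -> exists2 r, 0 < r & forall q, `|q - p| < r -> P q.
Proof.
move=> /nbhs_ballP[r /= r0 Hr]; exists r => // q qp.
by apply: Hr; rewrite -ball_normE /ball_/= distrC.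
Qed.

(** [G] is a formula for the gradient near [u] whose differentiability at [u] is known. First-order
    expansion there is enough: it gives [<w, grad> >= mu/2 |w|^2] and [|grad| <= M |w|] for
    [w = x - u], so the squared distance cannot grow once [a M^2 <= mu]. *)
Lemma gd_step_nonexpansive (R : realType) (d : nat) (h : 'rV[R]_d -> R) (u : 'rV[R]_d)
    (G : 'I_d -> 'rV[R]_d -> R) :
  (\forall x \near u, grad h x = \row_j G j x) -> (forall j, differentiable (G j) u) ->
  strong_local_minimizer h u ->
  exists r gamma, [/\ 0 < r, 0 < gamma & forall x a, `|x - u| < r -> 0 < a <= gamma ->
    enorm (x - a *: grad h x - u) <= enorm (x - u)].
Proof.
move=> hG dG [h0 /posdefmx_lower_bound[mu mu0 Hmu]].
pose Gr x := \row_j G j x.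
have dGr : is_diff u Gr (fun w => \row_j 'd (G j) u w).
  by apply: is_diff_row => j; exact: differentiableP.
have GrE w : 'd Gr u w = \row_j 'd (G j) u w by rewrite diff_val.
have Gu0 : Gr u = 0 by rewrite -h0 (nbhs_singleton hG).
have hessE i j : hess h u i j = 'd (G j) u (delta_mx ord0 i).
  rewrite mxE -deriveE//; apply: near_eq_derive.
  apply: filterS hG => x /(congr1 (fun w : 'rV_d => w ord0 j)).
  by rewrite !mxE.
have quadE w : dot w ('d Gr u w) = (w *m hess h u *m w^T) ord0 ord0.
  rewrite GrE mxE dotC; apply: eq_bigr => j _; rewrite [in LHS]mxE [in RHS]mxE mxE; congr (_ * _).
  by rewrite linear_row_sum; apply: eq_bigr => i _; rewrite hessE.
have dGr_le : exists2 c, 0 <= c & forall w, enorm ('d Gr u w) <= c * enorm w.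
  exists (d%:R * \sum_j \sum_i `|'d (G j) u (delta_mx ord0 i)|).
    by rewrite mulr_ge0// sumr_ge0// => j _; rewrite sumr_ge0.
  move=> w; rewrite -mulrA; apply: enorm_le_coord => [|j].
    by rewrite mulr_ge0 ?enorm_ge0// sumr_ge0// => j _; rewrite sumr_ge0.
  rewrite GrE mxE [X in `|X|](linear_row_sum ('d (G j) u)) (le_trans (ler_norm_sum _ _ _))//.
  apply: (@le_trans _ _ ((\sum_i `|'d (G j) u (delta_mx ord0 i)|) * enorm w)).
    rewrite mulr_suml ler_sum// => i _; rewrite normrM mulrC ler_wpM2l//.
    exact: coord_le_enorm.
  rewrite ler_wpM2r ?enorm_ge0// [leRHS](bigD1 j)//= lerDl.
  by rewrite sumr_ge0// => k _; rewrite sumr_ge0.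
have [c c0 Hc] := dGr_le.
(* Returning from the sup norm to [enorm] costs a factor [d], and [d * e] must not exceed
   [mu / 2]. *)
pose e := mu / 2 / (d%:R + 1).
have d1 : 0 < d%:R + 1 :> R by rewrite ltr_wpDl.
have e0 : 0 < e by rewrite !divr_gt0.
have [||r1 r10 Hr1] := @differentiable_estimate _ _ _ Gr u e.
- by case: dGr.
- by [].
have [r2 r20 Hr2] := near_ball hG.
pose M := c + mu.
have M0 : 0 < M by rewrite ltr_wpDl.
exists (Num.min r1 r2), (mu / M ^+ 2); split.
- by rewrite lt_min r10.
- by rewrite divr_gt0// exprn_gt0.
move=> x a; rewrite lt_min => /andP[x1 x2] /andP[a0].
rewrite ler_pdivlMr ?exprn_gt0// => aM.
rewrite Hr2// -/(Gr x); set w := x - u.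
have rem : enorm (Gr x - 'd Gr u w) <= mu / 2 * enorm w.
  have := Hr1 x x1; rewrite Gu0 subr0 -/w => Hx.
  rewrite (le_trans (enorm_le_norm _))// (le_trans (ler_wpM2l _ Hx))//.
  rewrite mulrA; apply: ler_pM; last exact: norm_le_enorm.
  - by rewrite mulr_ge0// ltW.
  - exact: normr_ge0.
  - rewrite /e mulrA ler_pdivrMr// mulrC ler_wpM2l ?lerDl//.
    by rewrite divr_ge0// ltW.
have -> : x - a *: Gr x - u = w - a *: Gr x by rewrite addrAC.
move: w rem => w rem.
have W0 := enorm_ge0 w.
have GE : Gr x = 'd Gr u w + (Gr x - 'd Gr u w) by rewrite addrC subrK.
have low : mu / 2 * dot w w <= dot w (Gr x).
  rewrite GE dotDr quadE.
  have := norm_dot_le w (Gr x - 'd Gr u w); rewrite ler_norml => /andP[+ _].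
  have := Hmu w; have := ler_wpM2l W0 rem; rewrite -enorm_sqr.
  set A := dot _ _; set B := _ ord0 ord0; set E := enorm w; set F := enorm _; nra.
have up : enorm (Gr x) <= M * enorm w.
  rewrite {1}GE (le_trans (enormD _ _))//.
  have := Hc w; move: rem; rewrite /M; nra.
apply: enorm_le => //.
rewrite dot_gd_step.
rewrite enorm_sqr gerBl mulr_ge0 ?(ltW a0)// subr_ge0.
apply: (@le_trans _ _ (mu * dot w w)); last by move: low; lra.
rewrite -!enorm_sqr (le_trans (ler_wpM2l (ltW a0) (_ : _ <= (M * enorm w) ^+ 2)))//.
  by rewrite lerXn2r ?nnegrE ?enorm_ge0// mulr_ge0// ltW.
by rewrite exprMn mulrA ler_wpM2r// sqr_ge0.
Qed.

(** * The graph of the implicit map and the gradient along it *)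

Section ImplicitMap.
Context {R : realType} {n m : nat}.
Local Notation V := ('rV[R]_n * 'rV[R]_m)%type.
Context (f g : V -> R) (hf : Ck_on 2 setT f) (hg : Ck_on 3 setT g).
Context (xs : 'rV[R]_n) (zs : 'rV[R]_m) (U : set 'rV[R]_n) (y : 'rV[R]_n -> 'rV[R]_m).
Context (himp : implicit_map g xs zs U y).

Let df q : differentiable f q.
Proof. by case: hf => H _; exact: H. Qed.

Let ddf a q : differentiable (fun q => 'd f q a) q.
Proof. by case: hf => _ /(_ a)[H _]; exact: H. Qed.

Let dy x : U x -> differentiable y x.
Proof. by case: himp => _ _ [H _] _ _; exact: H. Qed.

Let ddy v x : U x -> differentiable (fun x => 'd y x v) x.
Proof. by case: himp => _ _ [_ /(_ v)[H _]] _ _; exact: H. Qed.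

Lemma near_implicit_dom x : U x -> \forall x' \near x, U x'.
Proof. by case: himp => oU _ _ _ _ Ux; exact: open_nbhs_nbhs. Qed.

Lemma is_diff_graph x : U x -> is_diff x (fun x => (x, y x) : V) (fun u => (u, 'd y x u)).
Proof.
move=> Ux; exact: (is_diff_pair (is_diff_id x) (differentiableP (dy Ux))).
Qed.

(** Obtained by differentiating the equation that defines [y] on the open set [U]. It characterizes
    [y'(x)] as fixed by the tangent map, without inverting the Hessian. *)
Lemma dgrad_y_graph x u : U x -> dgrad_y g (x, y x) (u, 'd y x u) = 0.
Proof.
move=> Ux; have dG := is_diff_graph Ux.
have dC := is_diff_comp dG (is_diff_grad_y hg (x, y x)).
have <- : 'D_u ((fun q : V => grad_y g q.1 q.2) \o (fun x => (x, y x))) x =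
    dgrad_y g (x, y x) (u, 'd y x u).
  exact: (is_diff_derive u dC).
rewrite -(derive_cst (0 : 'rV[R]_m) x u); apply: near_eq_derive.
by apply: filterS (near_implicit_dom Ux) => x' Ux' /=; case: himp => _ _ _ _; exact.
Qed.

Lemma grad_graph x : U x ->
  grad (fun x => f (x, y x)) x = \row_j 'd f (x, y x) (delta_mx ord0 j, 'd y x (delta_mx ord0 j)).
Proof.
move=> Ux; apply/rowP => j; rewrite !mxE.
have dC := is_diff_comp (is_diff_graph Ux) (differentiableP (df (x, y x))).
exact: (is_diff_derive _ dC).
Qed.

Lemma differentiable_grad_graph x j : U x ->
  differentiable (fun x => 'd f (x, y x) (delta_mx ord0 j, 'd y x (delta_mx ord0 j))) x.
Proof.
move=> Ux.
have dG a : differentiable (fun x => 'd f (x, y x) a) x.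
  have -> : (fun x => 'd f (x, y x) a) = (fun q => 'd f q a) \o (fun x => (x, y x)) by [].
  by apply: differentiable_comp; [case: (is_diff_graph Ux)|exact: ddf].
(* Both the base point and the direction move with [x]. Expanding the direction over the basis
   leaves fixed directions with differentiable scalar coefficients. *)
have -> : (fun x => 'd f (x, y x) (delta_mx ord0 j, 'd y x (delta_mx ord0 j))) =
    (fun x => 'd f (x, y x) (delta_mx ord0 j, 0)) +
    \sum_i (fun x => 'd y x (delta_mx ord0 j) ord0 i * 'd f (x, y x) (0, delta_mx ord0 i)).
  apply/funext => x'; rewrite [RHS]/(_ + _) fct_sumE.
  transitivity ('d f (x', y x') ((delta_mx ord0 j, 0) + (0, 'd y x' (delta_mx ord0 j)))).
    congr ('d f _ _).
    by rewrite -[RHS]/(delta_mx ord0 j + 0, 0 + 'd y x' (delta_mx ord0 j)) addr0 add0r.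
  by rewrite linearD; congr (_ + _); exact: linear_pairr_sum.
apply: differentiableD; first exact: dG.
apply: differentiable_sum => i; apply: differentiableM; last exact: dG.
have -> : (fun x => 'd y x (delta_mx ord0 j) ord0 i) =
    (fun w : 'rV[R]_m => w ord0 i) \o (fun x => 'd y x (delta_mx ord0 j)) by [].
by apply: differentiable_comp; [exact: ddy|exact: differentiable_coord].
Qed.

Lemma implicit_map_near (e : R) : 0 < e -> exists r M, [/\ 0 < r, 0 <= M &
  forall x, `|x - xs| < r -> [/\ U x, enorm (y x - zs) < e &
    forall j, `|(delta_mx ord0 j, 'd y x (delta_mx ord0 j)) : V| <= M]].
Proof.
move=> e0; have [_ Uxs _ yxs _] := himp.
have m1 : 0 < m%:R + 1 :> R by rewrite ltr_wpDl.
have [r1 r10 Hr1] := near_ball (near_implicit_dom Uxs).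
have := differentiable_continuous (dy Uxs).
move=> /cvgrPdist_lt/(_ (e / (m%:R + 1)) (divr_gt0 e0 m1))/near_ball[r2 r20 Hr2].
have cd j : \forall x \near xs,
    `|(delta_mx ord0 j, 'd y x (delta_mx ord0 j)) : V| <= 1 + `|'d y xs (delta_mx ord0 j)| + 1.
  have := differentiable_continuous (ddy (delta_mx ord0 j) Uxs).
  move=> /cvgrPdist_lt/(_ 1 ltr01); apply: filterS => x Hx.
  rewrite prod_normE/= ge_max.
  apply/andP; split.
    rewrite (le_trans (norm_le_enorm _))// (le_trans (enorm_delta_le1 j))//.
    by rewrite -addrA lerDl addr_ge0.
  by rewrite -addrA (le_trans (norm_le_dist (ltW Hx)))// lerDr.
have /near_ball[r3 r30 Hr3] : \forall x \near xs, forall j : 'I_n,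
    `|(delta_mx ord0 j, 'd y x (delta_mx ord0 j)) : V| <= 1 + `|'d y xs (delta_mx ord0 j)| + 1.
  exact: (@filter_forall _ _ _ _ _ cd).
exists (Num.min r1 (Num.min r2 r3)), (1 + \sum_j `|'d y xs (delta_mx ord0 j)| + 1); split.
- by rewrite !lt_min r10 r20.
- by rewrite !addr_ge0// sumr_ge0.
move=> x; rewrite !lt_min => /and3P[x1 x2 x3]; split; first exact: Hr1.
- have := Hr2 x x2; rewrite yxs distrC => Hx.
  rewrite (le_lt_trans (enorm_le_norm _))// (le_lt_trans (ler_wpM2l _ (ltW Hx)))//.
  by rewrite mulrA ltr_pdivrMr// mulrC ltr_pM2l// ltrDl.
move=> j; rewrite (le_trans (Hr3 x x3 j))// lerD2r lerD2l [leRHS](bigD1 j)//= lerDl.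
by rewrite sumr_ge0.
Qed.

End ImplicitMap.

(** * Convergence of the gradients of [phik] *)

Section GradientPhik.
Context {R : realType} {n m : nat}.
Local Notation V := ('rV[R]_n * 'rV[R]_m)%type.
Context (f g : V -> R) (hf : Ck_on 2 setT f) (hg : Ck_on 3 setT g) (alpha : R).

Let df q : differentiable f q.
Proof. by case: hf => H _; exact: H. Qed.

Let is_diff_f_iter k q : is_diff q (f \o iter k (lower_gd_map g alpha))
  ('d f (iter k (lower_gd_map g alpha) q) \o iter_tangent g alpha k q).
Proof. exact: is_diff_comp (is_diff_iter hg alpha k q) (differentiableP (df _)). Qed.

Let phikE k x z : phik f g alpha k x z = (f \o iter k (lower_gd_map g alpha)) (x, z).
Proof. by rewrite /= iter_lower_gd_map. Qed.

Lemma grad_phik_x k x z : grad (fun x => phik f g alpha k x z) x =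
  \row_i 'd f (iter k (lower_gd_map g alpha) (x, z))
    (iter_tangent g alpha k (x, z) (delta_mx ord0 i, 0)).
Proof.
apply/rowP => i; rewrite !mxE.
have -> : (fun x => phik f g alpha k x z) =
    (fun x => (f \o iter k (lower_gd_map g alpha)) (x, z)).
  by apply/funext => x'; rewrite phikE.
have [dC EC] := is_diff_f_iter k (x, z).
transitivity ('d (f \o iter k (lower_gd_map g alpha)) (x, z) (delta_mx ord0 i, 0)).
  exact: (derive_pairl _ dC).
exact: (congr1 (fun F : V -> R => F (delta_mx ord0 i, 0)) EC).
Qed.

Lemma grad_phik_z k x z : grad (fun z => phik f g alpha k x z) z =
  \row_i 'd f (iter k (lower_gd_map g alpha) (x, z))
    (iter_tangent g alpha k (x, z) (0, delta_mx ord0 i)).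
Proof.
apply/rowP => i; rewrite !mxE.
have -> : (fun z => phik f g alpha k x z) =
    (fun z => (f \o iter k (lower_gd_map g alpha)) (x, z)).
  by apply/funext => z'; rewrite phikE.
have [dC EC] := is_diff_f_iter k (x, z).
transitivity ('d (f \o iter k (lower_gd_map g alpha)) (x, z) (0, delta_mx ord0 i)).
  exact: (derive_pairr _ dC).
exact: (congr1 (fun F : V -> R => F (0, delta_mx ord0 i)) EC).
Qed.

End GradientPhik.

Section GradientError.
Context {R : realType} {n m : nat}.
Local Notation V := ('rV[R]_n * 'rV[R]_m)%type.

Lemma diff_lipschitz_near (f : V -> R) (p : V) : Ck_on 2 setT f ->
  exists r K M, [/\ 0 < r, 0 <= K, 0 <= M,
    (forall q q' v, `|q - p| < r -> `|q' - p| < r ->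
      `|'d f q v - 'd f q' v| <= K * `|v| * `|q - q'|) &
    (forall q v, `|q - p| < r -> `|'d f q v| <= M * `|v|)].
Proof.
move=> hf.
have ddf v q : differentiable (fun q => 'd f q v) q.
  by case: hf => _ /(_ v)[H _]; exact: H.
have cddf v w : continuous (fun q => 'd (fun q => 'd f q v) q w).
  by move=> q; case: hf => _ /(_ v)[_ /(_ w)]; exact.
have lin q : linear (fun v : V => 'd f q v) by move=> a u v; exact: linearP.
have [r [K [r0 K0 HK]]] := near_linear_lipschitz p lin ddf cddf.
pose c := \sum_i `|'d f p (delta_mx ord0 i, 0)| + \sum_j `|'d f p (0, delta_mx ord0 j)|.
have c0 : 0 <= c by rewrite addr_ge0 ?sumr_ge0.
exists r, K, (c + K * r); split.
- exact: r0.
- exact: K0.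
- by rewrite addr_ge0 ?mulr_ge0 ?(ltW r0).
- by move=> q q' v qr q'r; exact: HK.
move=> q v qr.
have pr : `|p - p| < r by rewrite subrr normr0.
have Hq := HK q p qr pr v.
have Hp : `|'d f p v| <= c * `|v| by exact: linear_pair_le.
apply: le_trans (norm_le_dist (x := 'd f p v) (e := K * `|v| * `|q - p|) _) _.
  by rewrite distrC.
rewrite mulrDl lerD// mulrAC ler_wpM2r// ler_wpM2l// ltW//.
Qed.

Context (f g : V -> R) (hf : Ck_on 2 setT f) (hg : Ck_on 3 setT g) (L alpha : R).
Context (glip : forall x, lipschitz_grad L (fun y => g (x, y)))
  (alpha0 : 0 < alpha) (aL : alpha * L < 1).
Context (xs : 'rV[R]_n) (zs : 'rV[R]_m) (U : set 'rV[R]_n) (y : 'rV[R]_n -> 'rV[R]_m).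
Context (himp : implicit_map g xs zs U y)
  (Hpos : posdefmx (hess (fun z => g (xs, z)) zs)).

Lemma grad_phik_near : exists r C rho, [/\ 0 < r, 0 < C, 0 < rho < 1 &
  forall x z k, enorm (x - xs) < r -> enorm (z - zs) < r ->
    enorm (grad (fun x => phik f g alpha k x z) x - grad (fun x => f (x, y x)) x)
      <= C * rho ^+ k /\
    enorm (grad (fun z => phik f g alpha k x z) z) <= C * rho ^+ k].
Proof.
pose p : V := (xs, zs).
have [rg [K [rho [rg0 K0 rho01 contr lip]]]] := lower_gd_differential_near hg glip alpha0 aL Hpos.
have [rf [Kf [Mf [rf0 Kf0 Mf0 flip fbound]]]] := diff_lipschitz_near p hf.
have [r [r0 rrg rrf]] : exists r, [/\ 0 < r, forall q, `|q - p| < r -> `|q - p| < rg &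
    forall q, `|q - p| < r -> `|q - p| < rf].
  by exists (Num.min rg rf); split=> [|q|q]; rewrite lt_min ?rg0// => /andP[].
have {}contr q w : `|q - p| < r -> enorm (w - alpha *: dgrad_y g q (0, w)) <= rho * enorm w.
  by move=> /rrg; exact: contr.
have {}lip q q' v : `|q - p| < r -> `|q' - p| < r ->
    enorm (dgrad_y g q v - dgrad_y g q' v) <= K * `|v| * `|q - q'|.
  by move=> /rrg H /rrg; exact: lip.
have r4 : 0 < r / 4 by rewrite divr_gt0.
have [ry [M [ry0 M0 Hy]]] := implicit_map_near himp r4.
have /andP[rho0 rho1] := rho01.
pose rho' := (rho + 1) / 2.
have rr' : rho < rho' by rewrite /rho'; lra.
have rho'0 : 0 <= rho' by rewrite ltW// (lt_trans rho0).
have D0 : 0 < rho' - rho by rewrite subr_gt0.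
(* The first summand bounds [|Y|], the tangent error at [k = 0]; the second provides the inequality
   that closes the induction in [tangent_x_dist]. *)
pose C1 := m%:R * M + alpha * K * M * r / (rho' - rho).
have aKMr : 0 <= alpha * K * M * r by rewrite !mulr_ge0// ltW.
have C10 : 0 <= C1 by apply: addr_ge0; [rewrite mulr_ge0|rewrite divr_ge0// ltW].
pose C2 := Mf * C1 + Kf * M * r.
have C20 : 0 <= C2 by rewrite addr_ge0 ?mulr_ge0// ltW.
exists (Num.min (Num.min ry r) (r / 4)), (n%:R * C2 + m%:R * Mf + 1), rho'; split.
- by rewrite !lt_min ry0 r0.
- by rewrite ltr_wpDl// addr_ge0// mulr_ge0.
- by rewrite (lt_trans rho0)// /rho'; lra.
move=> x z k; rewrite !lt_min => /andP[/andP[xry xr] _] /andP[_ zr].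
have {}xry := le_lt_trans (norm_le_enorm _) xry.
have {}xr := le_lt_trans (norm_le_enorm _) xr.
have [Ux yxr yM] := Hy x xry.
have yx0 : grad_y g x (y x) = 0 by case: himp => _ _ _ _; exact.
have qr := iter_near hg r0 rho01 contr xr yx0 yxr zr k.
have qy := iter_fixpoint_dist hg r0 rho01 contr xr yx0 yxr zr k.
have fr := fixpoint_near (p := p) r0 xr yxr.
have rhok : rho ^+ k <= rho' ^+ k by rewrite lerXn2r ?nnegrE// ltW.
have rho'k : 0 <= rho' ^+ k by rewrite exprn_ge0.
split.
  rewrite grad_phik_x// (grad_graph hf himp Ux).
  apply: (@le_trans _ _ (n%:R * (C2 * rho' ^+ k))); last first.
    by rewrite mulrA ler_wpM2r// -addrA lerDl addr_ge0// mulr_ge0.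
  apply: enorm_le_coord => [|j]; first by rewrite mulr_ge0.
  rewrite !mxE; set q := iter k _ _ in qr qy *; set e := delta_mx ord0 j.
  set Y := 'd y x e; set t := iter_tangent _ _ _ _ _.
  have t1 : t.1 = e := iter_tangent1 g alpha k _ _.
  have YC1 : enorm Y <= C1.
    rewrite (le_trans (enorm_le_norm _))// (@le_trans _ _ (m%:R * M))//.
      by rewrite ler_wpM2l// (le_trans (norm_pairr (e, Y)))// yM.
    by rewrite lerDl divr_ge0// ltW.
  have tY : enorm (t.2 - Y) <= C1 * rho' ^+ k.
    apply: (tangent_x_dist hg r0 rho01 K0 alpha0 contr lip xr yx0 yxr zr (M := M) (rho1 := rho')).
    - exact: (dgrad_y_graph hg himp).
    - exact: yM.
    - exact: YC1.
    - exact: rr'.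
    - by rewrite /C1 mulrDl divfK ?gt_eqF// lerDr !mulr_ge0// ltW.
  have tE : t = (0, t.2 - Y) + (e, Y).
    by rewrite -[RHS]/(0 + e, t.2 - Y + Y) add0r subrK {1}[t]surjective_pairing t1.
  (* The two parts of [C2]: [Mf * C1] for the tangent error, [Kf * M * r] for the displacement of
     the point where [f] is differentiated. *)
  have -> : 'd f q t - 'd f (x, y x) (e, Y) =
      'd f q (0, t.2 - Y) + ('d f q (e, Y) - 'd f (x, y x) (e, Y)).
    by rewrite addrA; congr (_ - _); rewrite {1}tE; exact: linearD.
  rewrite (le_trans (ler_normD _ _))// /C2 mulrDl lerD//.
    rewrite (le_trans (fbound _ _ (rrf _ qr)))// -mulrA ler_wpM2l//.
    by rewrite (le_trans (norm_snd_le_enorm _)).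
  rewrite (le_trans (flip _ _ _ (rrf _ qr) (rrf _ fr)))//.
  rewrite -[leRHS]mulrA ler_pM ?mulr_ge0//; first by rewrite ler_wpM2l// yM.
  by rewrite (le_trans qy)// mulrC ler_wpM2l// ltW.
rewrite grad_phik_z//.
apply: (@le_trans _ _ (m%:R * (Mf * rho' ^+ k))); last first.
  by rewrite mulrA ler_wpM2r// addrAC lerDr addr_ge0// mulr_ge0.
apply: enorm_le_coord => [|j]; first by rewrite mulr_ge0.
rewrite mxE; set t := iter_tangent _ _ _ _ _.
have t1 : t.1 = 0 := iter_tangent1 g alpha k _ _.
have tE : t = (0, t.2) by rewrite {1}[t]surjective_pairing t1.
rewrite (le_trans (fbound _ _ (rrf _ qr)))// ler_wpM2l// tE.
rewrite (le_trans (norm_snd_le_enorm _))// (le_trans (tangent_z_decay hg r0 rho01 contr xr yx0 yxr zr k _))//.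
by rewrite (le_trans _ rhok)// ler_piMr ?enorm_delta_le1// exprn_ge0// ltW.
Qed.

End GradientError.

(** * Accumulation of the gradient errors along the iterations *)

Theorem theorem5p3 (R : realType) (n m : nat) (hn : (0 < n)%N) (hm : (0 < m)%N)
  (f g : 'rV[R]_n * 'rV[R]_m -> R)
  (hf : Ck_on 2 setT f) (hg : Ck_on 3 setT g)
  (Lg : R) (hLg : 0 < Lg)
  (hgcoer : forall x : 'rV[R]_n, coercive (fun y : 'rV[R]_m => g (x, y)))
  (hglip : forall x : 'rV[R]_n, lipschitz_grad Lg (fun y : 'rV[R]_m => g (x, y)))
  (alphag : R) (halphag : 0 < alphag * Lg < 1)
  (xs : 'rV[R]_n) (zs : 'rV[R]_m)
  (hmin : bilevel_strong_local_minimizer f g xs zs) :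
  exists delta gamma C rho : R,
    [/\ 0 < delta, 0 < gamma, 0 < C, 0 < rho < 1 &
      forall (alphaf : R) (k : nat), 0 < alphaf <= gamma ->
      forall (x : 'rV[R]_n) (z : 'rV[R]_m),
        enorm (x - xs) + enorm (z - zs) < delta ->
      forall l : nat,
        l%:R <= (delta - enorm (x - xs) - enorm (z - zs)) / (alphaf * C * rho ^+ k) ->
        enorm ((dpbg f g alphaf alphag k (x, z) l).1 - xs) +
        enorm ((dpbg f g alphaf alphag k (x, z) l).2 - zs) <= delta].
Proof.
case: hmin => -[_ Hpos] [U [y [himp hphi]]].
have /andP[aL0 aL1] := halphag.
have alpha0 : 0 < alphag by move: aL0; rewrite pmulr_lgt0.
have [rE [C [rho [rE0 C0 rho01 Herr]]]] := grad_phik_near hf hg hglip alpha0 aL1 himp Hpos.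
have Uxs : U xs by case: himp.
have phiG : \forall x \near xs, grad (fun x => f (x, y x)) x =
    \row_j 'd f (x, y x) (delta_mx ord0 j, 'd y x (delta_mx ord0 j)).
  by apply: filterS (near_implicit_dom himp Uxs) => x; exact: (grad_graph hf himp).
have [rD [gamma [rD0 gamma0 Hdesc]]] := gd_step_nonexpansive phiG
  (fun j => differentiable_grad_graph hf himp j Uxs) hphi.
(* Strictly below both radii, because iterates may reach distance exactly [delta] while the
   estimates hold on open balls. *)
have [delta [d0 dE dD]] : exists delta, [/\ 0 < delta, delta < rE & delta < rD].
  exists (Num.min rE rD / 2); have m0 : 0 < Num.min rE rD by rewrite lt_min rE0.
  have m2 : Num.min rE rD / 2 < Num.min rE rD by rewrite ltr_pdivrMr// ltr_pMr// ltr1n.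
  by split; [rewrite divr_gt0|rewrite (lt_le_trans m2)// ge_min lexx|
    rewrite (lt_le_trans m2)// ge_min lexx orbT].
exists delta, gamma, (2 * C), rho; split => //; first by rewrite mulr_gt0.
move=> a k aP x z xz.
have /andP[a0 _] := aP; have /andP[rho0 _] := rho01.
pose D (q : 'rV[R]_n * 'rV[R]_m) := enorm (q.1 - xs) + enorm (q.2 - zs).
pose E := a * (2 * C) * rho ^+ k.
have E0 : 0 < E by rewrite !mulr_gt0// exprn_gt0.
have step q : D q <= delta -> D (dpbg_step f g a alphag k q) <= D q + E.
  case: q => q1 q2; rewrite /D/= => Dq.
  have q1d : enorm (q1 - xs) <= delta by apply: le_trans Dq; rewrite lerDl enorm_ge0.
  have q2d : enorm (q2 - zs) <= delta by apply: le_trans Dq; rewrite lerDr enorm_ge0.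
  have [Hx Hz] := Herr q1 q2 k (le_lt_trans q1d dE) (le_lt_trans q2d dE).
  have Hq1 := Hdesc q1 a (le_lt_trans (norm_le_enorm _) (le_lt_trans q1d dD)) aP.
  have S1 := enorm_perturbed_step q1 (grad (fun x => phik f g alphag k x q2) q1)
    (grad (fun x => f (x, y x)) q1) xs (ltW a0).
  (* The reference step in [z] has gradient 0 and does not move, so the whole [z]-gradient counts as
     error. *)
  have S2 := enorm_perturbed_step q2 (grad (fun z => phik f g alphag k q1 z) q2) 0 zs (ltW a0).
  rewrite scaler0 !subr0 in S2.
  have -> : E = a * (C * rho ^+ k) + a * (C * rho ^+ k) by rewrite /E; ring.
  rewrite addrACA lerD//.
    by rewrite (le_trans S1)// lerD// ler_wpM2l// ltW.
  by rewrite (le_trans S2)// lerD// ler_wpM2l// ltW.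
(* The condition on [l] passes to smaller indices, and together with the induction hypothesis it
   keeps the previous iterate within [delta], as [step] requires. *)
suff main l : l%:R * E <= delta - D (x, z) ->
    D (dpbg f g a alphag k (x, z) l) <= D (x, z) + l%:R * E.
  move=> l; rewrite ler_pdivlMr// -/E => lE.
  have lE' : l%:R * E <= delta - D (x, z) by rewrite /D/= opprD addrA.
  by rewrite (le_trans (main l lE'))// -lerBrDl.
elim: l => [|l IH] lE; first by rewrite mul0r addr0.
have lE' : l%:R * E <= delta - D (x, z).
  by rewrite (le_trans _ lE)// ler_pM2r// ler_nat.
rewrite /dpbg iterS (le_trans (step _ _))//.
  by rewrite (le_trans (IH lE'))// -lerBrDl.
by rewrite -natr1 mulrDl mul1r addrA lerD2r; exact: IH.
Qed.
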